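(* Let $p_1\equiv p_2\equiv1\pmod4$ be primes and $\mathbb{K}=\mathbb{Q}(\sqrt2,\sqrt{p_1p_2},i)$, with maximal real subfield $\mathbb{K}^+=\mathbb{Q}(\sqrt2,\sqrt{p_1p_2})$. Let $\varepsilon_1,\varepsilon_2,\varepsilon_3$ be the fundamental units of $\mathbb{Q}(\sqrt2)$, $\mathbb{Q}(\sqrt{p_1p_2})$, $\mathbb{Q}(\sqrt{2p_1p_2})$ respectively, and write $\varepsilon_3=x+y\sqrt{2p_1p_2}$ with $x,y\in\mathbb{Z}$. Then $Q_{\mathbb{K}}=1$ and: (1) If $N(\varepsilon_2)=N(\varepsilon_3)=-1$: (i) if $\varepsilon_1\varepsilon_2\varepsilon_3$ is a square in $\mathbb{K}^+$, then $\{\varepsilon_1,\varepsilon_2,\sqrt{\varepsilon_1\varepsilon_2\varepsilon_3}\}$ is an F.S.U. of $\mathbb{K}^+$ and of $\mathbb{K}$; (ii) otherwise $\{\varepsilon_1,\varepsilon_2,\varepsilon_3\}$ is an F.S.U. of $\mathbb{K}^+$ and of $\mathbb{K}$. (2) If $N(\varepsilon_2)=1$ and $N(\varepsilon_3)=-1$: $\{\varepsilon_1,\varepsilon_2,\varepsilon_3\}$ is an F.S.U. of $\mathbb{K}^+$ and of $\mathbb{K}$. (3) If $N(\varepsilon_3)=1$ and $N(\varepsilon_2)=-1$: (i) if $x+1$ or $x-1$ is a perfect square in $\mathbb{N}$, then $\{\varepsilon_1,\varepsilon_2,\sqrt{\varepsilon_3}\}$ is an F.S.U. of $\mathbb{K}^+$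 and of $\mathbb{K}$; (ii) otherwise $\{\varepsilon_1,\varepsilon_2,\varepsilon_3\}$ is an F.S.U. of $\mathbb{K}^+$ and of $\mathbb{K}$. (4) If $N(\varepsilon_2)=N(\varepsilon_3)=1$: (i) if $x+1$ or $x-1$ is a perfect square in $\mathbb{N}$, then $\{\varepsilon_1,\varepsilon_2,\sqrt{\varepsilon_3}\}$ is an F.S.U. of $\mathbb{K}^+$ and of $\mathbb{K}$; (ii) otherwise $\{\varepsilon_1,\varepsilon_2,\sqrt{\varepsilon_2\varepsilon_3}\}$ is an F.S.U. of $\mathbb{K}^+$ and of $\mathbb{K}$.
   Context: $i=\sqrt{-1}$; $N(\cdot)$ is the norm from the relevant real quadratic field to $\mathbb{Q}$. An F.S.U. (fundamental system of units) of a number field $L$ is a set of units whose images form a basis of the free abelian group $E_L/W_L$, where $E_L$ is the unit group of $\mathcal{O}_L$ and $W_L$ the group of roots of unity in $L$. For a CM-field $L$ with maximal real subfield $L^+$, Hasse's unit index is $Q_L=[E_L:W_LE_{L^+}]$. *)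

(* Defs.v *)
From HB Require Import structures.
From mathcomp Require Import all_boot all_order all_algebra all_field.
Set Implicit Arguments. Unset Strict Implicit. Unset Printing Implicit Defensive.
Import Order.TTheory GRing.Theory Num.Theory.
Local Open Scope ring_scope.

Definition Qsqrt (d : nat) (z : algC) : Prop :=
  exists a b : rat, z = ratr a + ratr b * sqrtC d%:R.

Definition Kplus (m : nat) (z : algC) : Prop :=
  exists a b c e : rat,
    z = ratr a + ratr b * sqrtC 2 + ratr c * sqrtC m%:R
        + ratr e * (sqrtC 2 * sqrtC m%:R).

Definition Kfull (m : nat) (z : algC) : Prop :=
  exists u v : algC, Kplus m u /\ Kplus m v /\ z = u + 'i * v.

Definition unit_of (F : algC -> Prop) (z : algC) : Prop :=
  F z /\ z \in Aint /\ z != 0 /\ z^-1 \in Aint.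

Definition root_of_unity (z : algC) : Prop :=
  exists n : nat, (0 < n)%N /\ z ^+ n = 1.

(* {u1,u2,u3} is a fundamental system of units of F: they are units and their
   images form a basis of the free abelian group E_F / W_F. *)
Definition FSU (F : algC -> Prop) (u1 u2 u3 : algC) : Prop :=
  [/\ unit_of F u1, unit_of F u2, unit_of F u3,
      (forall e, unit_of F e -> exists (w : algC) (a1 a2 a3 : int),
          F w /\ root_of_unity w /\ e = w * (u1 ^ a1 * u2 ^ a2 * u3 ^ a3))
    & (forall a1 a2 a3 : int, root_of_unity (u1 ^ a1 * u2 ^ a2 * u3 ^ a3) ->
          [/\ a1 = 0, a2 = 0 & a3 = 0])].

Definition fund_unit (d : nat) (e : algC) : Prop :=
  [/\ unit_of (Qsqrt d) e, 1 < e &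
      forall u, unit_of (Qsqrt d) u -> exists n : int, u = e ^ n \/ u = - e ^ n].

Definition normQ (d : nat) (e : algC) (n : int) : Prop :=
  exists a b : rat, e = ratr a + ratr b * sqrtC d%:R /\ a ^+ 2 - d%:R * b ^+ 2 = n%:~R.

(* Hasse's unit index Q_L = [E_L : W_L E_{L^+}] equals 1, i.e. E_L = W_L E_{L^+} *)
Definition hasse_index_one (L Lp : algC -> Prop) : Prop :=
  forall e, unit_of L e -> exists w u, L w /\ root_of_unity w /\ unit_of Lp u /\ e = w * u.

(* Main.v *)
(** Let sg2 and sgm be the automorphisms negating only [sqrt 2], respectively only
    [sqrt m], where [m = p1 p2].  The product of the norms of a unit [u] of K+ to the
    three quadratic subfields is [u^2] up to sign, so [u^2 = e1^a e2^b e3^c], and an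
    F.S.U. is determined by which products of [e1, e2, e3] with exponents 0 or 1 are
    squares in K+.  Taking norms of such a square excludes most exponents, since
    [N e1 = -1].  A unit of Q(sqrt m) is never twice a square, because [m = 1 mod 4];
    hence [e2] is not a square in K+.  When [N e3 = 1], [e3] is a square in K+ exactly
    if [x + 1] or [x - 1] is a perfect square.  When a unit [u] has norm 1,
    [(u + 1)^2 = u (Tr u + 2)], and factoring [(Tr u)^2 - 4] shows that [u] or [p1 u] is
    a square in K+; so if neither [e2] nor [e3] is a square, then [e2 e3] is one.

    For the unit index, let [e] be a unit of K.  The fourth power of [z = e / conj e] is
    a product of squares of units of the four imaginary quadratic subfields, whence
    [z^24 = 1].  If [z^3], which belongs to [e^3], is the square of a root of unity [w]
    of K, then [e^3 / w] is real; otherwise it is a primitive 8th root of unity and the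
    norm of [e^3] produces a unit of Q(sqrt m) that is twice a square. *)

Require Import Defs.
From HB Require Import structures.
From mathcomp Require Import all_boot all_order all_algebra all_field.
From mathcomp Require Import ring lra zify.
Import Order.TTheory GRing.Theory Num.Theory.
Local Open Scope ring_scope.
Set Implicit Arguments. Unset Strict Implicit. Unset Printing Implicit Defensive.

(** * Automorphisms of algC moving a square root *)

(* [P] is any subring bounding the field generated by [s] from above. *)
Lemma aut_sqrt_exists (s : seq algC) (r : algC) (d : rat) (P : algC -> Prop) :
    (forall q : rat, P (ratr q)) ->
    (forall u v, P u -> P v -> P (u + v)) ->
    (forall u v, P u -> P v -> P (u * v)) ->
    {in s, forall u, P u} -> ~ P r -> r ^+ 2 = ratr d ->
  exists2 nu : {rmorphism algC -> algC}, {in s, nu =1 id} & nu r = - r.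
Proof.
move=> Pq PD PM Ps P'r rr.
(* [L] is a number field with embedding [LC], generated by preimages of [s] and [r]; [x] is the
   preimage of [r], and [E] is generated by the preimages [t] of [s]. *)
have [L [LC [t]]] := num_field_exists (rcons s r).
case/lastP: t => [|t x]; first by case: s {Ps}.
rewrite map_rcons => /eqP; rewrite eqseq_rcons => /andP[/eqP Dt /eqP Dx].
rewrite adjoin_rcons; set E := <<1 & t>>%AS => genL.
(* Elements of [E] are iterated polynomials in the generators over the rationals, so closure under
   sums and products keeps their images in [P]; as [r] is outside [P], [x] is outside [E]. *)
have PE z : z \in E -> P (LC z).
  have: {in t, forall u, P (LC u)} by move=> u tu; apply: Ps; rewrite -Dt map_f.
  rewrite {}/E {Dt genL} /=; elim/last_ind: t z => [|t u IHt] z Pt.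
    rewrite Fadjoin_nil => /vlineP[k ->].
    by rewrite alg_num_field fmorph_rat.
  rewrite adjoin_rcons => /Fadjoin_polyP[p /polyOverP Ep ->].
  have Ptu : {in t, forall v, P (LC v)}.
    by move=> v tv; apply: Pt; rewrite mem_rcons inE tv orbT.
  rewrite horner_coef rmorph_sum /=.
  elim/big_ind: _ => [|//|i _]; first by have := Pq 0; rewrite rmorph0.
  rewrite rmorphM rmorphXn; apply: (PM); first exact: IHt.
  have Pu : P (LC u) by apply: Pt; rewrite mem_rcons inE eqxx.
  have P1 : P 1 by have := Pq 1; rewrite rmorph1.
  by case: i => n _ /=; elim: n => [//|n IHn]; rewrite exprS; exact: PM.
have E'x : x \notin E by apply/negP => /PE; rewrite Dx.
have xx : x ^+ 2 = d%:A.
  by apply: (fmorph_inj LC); rewrite rmorphXn /= Dx alg_num_field fmorph_rat.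
(* The degree of [x] over [E] is at most 2, and it is not 1 because [x] is outside [E]. *)
have min_x : minPoly E x %= 'X^2 - d%:A%:P.
  have dvd_x : minPoly E x %| 'X^2 - d%:A%:P.
    apply: minPoly_dvdp; last by rewrite /root !hornerE xx subrr.
    by rewrite rpredB ?rpredX ?polyOverX // polyOverC memvZ ?mem1v.
  rewrite -(dvdp_size_eqp dvd_x) eqn_leq dvdp_leq -?size_poly_eq0 ?size_XnsubC //.
  have : adjoin_degree E x != 1%N by rewrite adjoin_deg_eq1.
  by rewrite size_minPoly; case: (adjoin_degree E x) (isT : (0 < adjoin_degree E x)%N) => [|[]].
have rootNx : root (map_poly \1%VF (minPoly E x)) (- x).
  rewrite (eq_map_poly (g := id)) => [|a]; last by rewrite id_lfunE.
  by rewrite map_poly_id // (eqp_root min_x) /root !hornerE sqrrN xx subrr.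
have homE : kHom 1 E (\1%VF : 'End(L)) by rewrite kHom1.
(* Since [- x] is also a root of the minimal polynomial of [x], the identity of [E] extends to a
   morphism of [L] negating [x], which then extends to [algC]. *)
pose phi := kHomExtend E \1 x (- x).
have phim : monoid_morphism phi.
  by apply/kHom_monoid_morphism; rewrite -genL kHomExtendP ?sub1v.
pose phimM := GRing.isMonoidMorphism.Build _ _ phi phim.
pose phiRM : {rmorphism _ -> _} := HB.pack (fun_of_lfun phi) phimM.
have [nu Dnu] := extend_algC_subfield_aut LC phiRM.
exists nu => [u|]; last first.
  by rewrite -Dx -Dnu /= (kHomExtend_val homE) ?rmorphN.
rewrite -Dt => /mapP[v tv ->]; rewrite -Dnu /= kHomExtend_id ?id_lfunE //.
by apply: seqv_sub_adjoin.
Qed.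

(** If [p] is the minimal polynomial of [x^2], monic with integer coefficients, then [x] is a root
    of [p(X^2)]. *)
Lemma Aint_sqrt (x : algC) : x ^+ 2 \in Aint -> x \in Aint.
Proof.
have [p [Dp mon_p] _] := minCpolyP (x ^+ 2) => Ax2.
have sX : (1 < size ('X^2 : {poly algC}))%N by rewrite size_polyXn.
apply: (@root_monic_Aint (minCpoly (x ^+ 2) \Po 'X^2)).
- by rewrite /root horner_comp !hornerE (eqP (root_minCpoly _)).
- by rewrite monicE lead_coef_comp // lead_coefXn expr1n mulr1 Dp lead_coef_map
             (monicP mon_p) rmorph1.
- by rewrite polyOver_comp // rpredX // polyOverX.
Qed.

Lemma ratr_inj : injective (ratr : rat -> algC).
Proof. exact: fmorph_inj. Qed.

(* Typed in [algC], so that products with them use the instances of [algC] itself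
   rather than those of a generic [numClosedFieldType]. *)
Definition rt (k : nat) : algC := sqrtC k%:R.
Definition ii : algC := 'i.

Lemma rt_sqr (k : nat) : rt k ^+ 2 = ratr k%:R.
Proof. by rewrite sqrtCK ratr_nat. Qed.

Lemma rt_real (k : nat) : rt k \is Num.real.
Proof. by rewrite ger0_real // sqrtC_ge0 ler0n. Qed.

Lemma ii_sqr : ii ^+ 2 = -1. Proof. exact: sqrCi. Qed.

(** In [numerator^2 = k * denominator^2] the valuation at [p] is even on the left and odd on the
    right. *)
Lemma odd_logn_not_square (p k : nat) (q : rat) :
  prime p -> odd (logn p k) -> q ^+ 2 = k%:R -> False.
Proof.
move=> p_pr odd_k Dq.
have k_gt0 : (0 < k)%N by case: k odd_k {Dq}; rewrite ?logn0.
have E : (`|numq q| ^ 2 = k * `|denq q| ^ 2)%N.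
  have : (numq q) ^+ 2 = k%:Z * (denq q) ^+ 2.
    apply: (@intr_inj rat); rewrite [RHS]intrM (_ : k%:Z%:~R = q ^+ 2) //.
    by rewrite !expr2 !intrM numqE; ring.
  by move=> /(congr1 absz); rewrite abszM !abszX => ->.
have := congr1 (logn p) E.
rewrite lognM ?expn_gt0 ?absz_gt0 ?denq_neq0 // !lognX.
by move/(congr1 odd); rewrite oddD !oddM /= odd_k.
Qed.

(** The field Q(i, sqrt l), used as the bounding subring when another square root is to be
    negated. *)
Definition Kspan (l : nat) (z : algC) : Prop := exists a b c e : rat,
  z = ratr a + ratr b * rt l + ii * (ratr c + ratr e * rt l).

(** Taking real parts leaves [sqrt k = a + b sqrt l]. After squaring, either [2 a b] is nonzero and
    [sqrt l] is rational, or [a = 0] and [k l = (b l)^2], or [b = 0] and [k = a^2]. *)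
Lemma Kspan_sqrt (k l : nat) :
  (forall q : rat, q ^+ 2 <> k%:R) -> (forall q : rat, q ^+ 2 <> l%:R) ->
  (forall q : rat, q ^+ 2 <> (k * l)%:R) -> ~ Kspan l (rt k).
Proof.
move=> nk nl nkl [a [b [c [e D]]]].
have re_q (u v : rat) : ratr u + ratr v * rt l \is Num.real.
  by apply/realD/realM/rt_real; exact: rpred_rat.
have E : rt k = ratr a + ratr b * rt l.
  have := congr1 (fun z => 'Re z) D; rewrite Re_rect ?re_q // => <-.
  by rewrite (Creal_ReP _ _) ?rt_real.
have {E} := congr1 (fun z => z ^+ 2) E; rewrite /= rt_sqr => E.
have {}E : ratr k%:R = ratr (a ^+ 2 + b ^+ 2 * l%:R) + ratr (a * b *+ 2) * rt l.
  by rewrite E mulr2n !(rmorphM, rmorphD, rmorphXn) /= -rt_sqr; ring.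
have [ab0|ab0] := eqVneq (a * b *+ 2) 0; last first.
  apply: (nl ((k%:R - (a ^+ 2 + b ^+ 2 * l%:R)) / (a * b *+ 2))).
  apply: ratr_inj; rewrite -rt_sqr rmorphXn; congr (_ ^+ 2).
  have ab : ratr (a * b *+ 2) != 0 :> algC by rewrite fmorph_eq0.
  by rewrite rmorphM fmorphV rmorphB /= E addrAC subrr add0r mulrAC mulfV ?mul1r.
move: E; rewrite ab0 rmorph0 mul0r addr0 => /ratr_inj E.
move/eqP: ab0; rewrite mulrn_eq0 /= mulf_eq0 => /orP[/eqP a0|/eqP b0].
  by apply: (nkl (b * l%:R)); rewrite natrM E a0; ring.
by apply: (nk a); rewrite E b0; ring.
Qed.

Lemma aut_sqrt_nat (k l : nat) :
  (forall q : rat, q ^+ 2 <> k%:R) -> (forall q : rat, q ^+ 2 <> l%:R) ->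
  (forall q : rat, q ^+ 2 <> (k * l)%:R) ->
  exists nu : {rmorphism algC -> algC},
    [/\ nu (rt k) = - rt k, nu (rt l) = rt l & nu ii = ii].
Proof.
move=> nk nl nkl.
have [||||||nu Fnu Dnu] := @aut_sqrt_exists [:: rt l; ii] (rt k) k%:R (Kspan l).
- by move=> q; exists q, 0, 0, 0; rewrite !rmorph0; ring.
- move=> _ _ [a [b [c [e ->]]]] [a' [b' [c' [e' ->]]]].
  by exists (a + a'), (b + b'), (c + c'), (e + e'); rewrite !rmorphD /=; ring.
- move=> _ _ [a [b [c [e ->]]]] [a' [b' [c' [e' ->]]]].
  exists (a * a' + l%:R * b * b' - c * c' - l%:R * e * e'), (a * b' + b * a' - c * e' - e * c'),
    (a * c' + c * a' + l%:R * (b * e' + e * b')), (a * e' + b * c' + e * a' + c * b').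
  rewrite !(rmorphB, rmorphD, rmorphM) /= -rt_sqr.
  by have i2 := ii_sqr; ring: i2.
- move=> z; rewrite !inE => /orP[]/eqP->.
    by exists 0, 1, 0, 0; rewrite !(rmorph0, rmorph1); ring.
  by exists 0, 0, 1, 0; rewrite !(rmorph0, rmorph1); ring.
- exact: Kspan_sqrt.
- exact: rt_sqr.
by exists nu; split=> [||]; rewrite ?Dnu // Fnu ?inE ?eqxx ?orbT.
Qed.

(** * Square classes of integers *)

Lemma even_logn_square (n : nat) : (0 < n)%N ->
  (forall q, prime q -> ~~ odd (logn q n)) -> exists r, n = (r ^ 2)%N.
Proof.
move=> n_gt0 even_n; exists (\prod_(0 <= q < n.+1) q ^ (logn q n)./2)%N.
rewrite -[LHS](partnT n_gt0) -mulnn -big_split /partn; apply: eq_big => // q _ /=.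
have [q_pr|q'_pr] := boolP (prime q).
  by rewrite -expnD addnn even_halfK ?even_n.
by rewrite lognE (negbTE q'_pr).
Qed.

(** A prime other than 2, [p1], [p2] with odd valuation in [P] has odd valuation in [M] too, hence
    divides [P - M = 4], which is absurd. So the square class of [P] involves only 2, [p1] and
    [p2]. *)
Lemma square_class (p1 p2 l P M c : nat) :
  prime p1 -> prime p2 -> p1 != p2 -> p1 != 2%N -> p2 != 2%N ->
  (l = p1 * p2)%N \/ (l = 2 * (p1 * p2))%N -> (0 < M)%N -> P = (M + 4)%N ->
  (l * (P * M) = c ^ 2)%N ->
  exists d r : nat, d \in [:: 1; 2; p1 * p2; 2 * (p1 * p2)]%N /\
    ((P * d = r ^ 2)%N \/ (p1 * P * d = r ^ 2)%N).
Proof.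
move=> p1_pr p2_pr p12 p1_2 p2_2 Dl M_gt0 DP Ec.
have P_gt0 : (0 < P)%N by rewrite DP addn4.
have [p1_gt0 p2_gt0] := (prime_gt0 p1_pr, prime_gt0 p2_pr).
have l_gt0 : (0 < l)%N by case: Dl => ->; rewrite !muln_gt0 p1_gt0.
have even_log q : prime q -> q != 2%N -> q != p1 -> q != p2 -> ~~ odd (logn q P).
  move=> q_pr q2 q1 q3; apply/negP => oP.
  have lq : logn q l = 0%N.
    by case: Dl => ->; rewrite !lognM ?muln_gt0 ?p1_gt0 // !logn_prime // (negbTE q1) (negbTE q3) ?(negbTE q2).
  have := congr1 (logn q) Ec; rewrite lognX !lognM ?muln_gt0 ?P_gt0 // lq add0n => E.
  have oM : odd (logn q M).
    by have := congr1 odd E; rewrite oddD oddM oP /= => /negbT; rewrite negbK.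
  have qP : (q %| P)%N by move: oP; case: (posnP (logn q P)) => [->//|]; rewrite logn_gt0 mem_primes => /and3P[].
  have qM : (q %| M)%N by move: oM; case: (posnP (logn q M)) => [->//|]; rewrite logn_gt0 mem_primes => /and3P[].
  have : (q %| 2 ^ 2)%N by rewrite DP dvdn_addr in qP.
  by rewrite Euclid_dvdX // dvdn_prime2 // => /andP[/eqP q2' _]; rewrite q2' in q2.
pose a := odd (logn 2 P); pose b := odd (logn p1 P); pose c' := odd (logn p2 P).
have [r Er] : exists r, (P * (2 ^ a * p1 ^ b * p2 ^ c') = r ^ 2)%N.
  apply: even_logn_square => [|q q_pr]; first by rewrite !muln_gt0 P_gt0 !expn_gt0 p1_gt0 p2_gt0.
  rewrite !lognM ?muln_gt0 ?expn_gt0 ?p1_gt0 ?p2_gt0 // !lognX.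
  rewrite (logn_prime q (isT : prime 2)) (logn_prime q p1_pr) (logn_prime q p2_pr).
  have [->|q2] := eqVneq q 2%N.
    by rewrite ![2%N == _]eq_sym (negbTE p1_2) (negbTE p2_2) !muln0 !addn0 muln1 oddD oddb addbb.
  have [->|q1] := eqVneq q p1.
    by rewrite (negbTE p12) !muln0 addn0 muln1 oddD oddb addbb.
  have [->|q3] := eqVneq q p2; last by rewrite !muln0 !addn0 even_log.
  by rewrite !muln0 muln1 oddD oddb addbb.
(* When exactly one of [p1], [p2] has odd valuation in [P], the extra factor [p1] makes both even or
   both odd. *)
case: a b c' Er => [] [] [] /=; rewrite ?expn0 ?expn1 => Er;
  [exists (2 * (p1 * p2))%N, r | exists 2%N, r | exists (2 * (p1 * p2))%N, (p1 * r)%N | exists 2%N, r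
  |exists (p1 * p2)%N, r | exists 1%N, r | exists (p1 * p2)%N, (p1 * r)%N | exists 1%N, r];
  (split; first by rewrite !inE eqxx ?orbT); rewrite ?expnMn -Er.
- by left; ring.
- by right; ring.
- by right; ring.
- by left; ring.
- by left; ring.
- by right; ring.
- by right; ring.
by left; ring.
Qed.

(** * Units *)

Lemma rt_gt0 (k : nat) : (0 < k)%N -> 0 < rt k.
Proof. by move=> k0; rewrite sqrtC_gt0 ltr0n. Qed.

Lemma rtM (k l : nat) : rt (k * l) = rt k * rt l.
Proof. by rewrite /rt natrM sqrtCM // nnegrE ler0n. Qed.

Lemma conj_rt (k : nat) : (rt k)^* = rt k.
Proof. by apply/CrealP/rt_real. Qed.

Lemma conj_ii : ii^* = - ii.
Proof. exact: conjCi. Qed.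

Lemma eq_by_sub (u v x y : algC) : u = v -> x - y = u - v -> x = y.
Proof. by move=> -> /eqP; rewrite subrr subr_eq0 => /eqP. Qed.

Section Unit.
Variables (F : algC -> Prop).
Hypotheses (FM : forall u v, F u -> F v -> F (u * v)) (FV : forall u, F u -> F u^-1) (F1 : F 1).

Lemma unit_of_neq0 u : unit_of F u -> u != 0. Proof. by case=> _ [_ []]. Qed.

Lemma unit_ofM u v : unit_of F u -> unit_of F v -> unit_of F (u * v).
Proof.
move=> [Fu [Au [u0 Au']]] [Fv [Av [v0 Av']]]; split; first exact: FM.
by rewrite mulf_neq0 // invfM !rpredM.
Qed.

Lemma unit_ofV u : unit_of F u -> unit_of F u^-1.
Proof. by move=> [Fu [Au [u0 Au']]]; split; [exact: FV | rewrite invr_eq0 invrK]. Qed.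

Lemma unit_of1 : unit_of F 1.
Proof. by split=> //; rewrite invr1 oner_neq0 rpred1. Qed.

Lemma unit_ofX u (n : nat) : unit_of F u -> unit_of F (u ^+ n).
Proof.
by move=> Uu; elim: n => [|n IHn]; [exact: unit_of1 | rewrite exprS; exact: unit_ofM].
Qed.

Lemma unit_ofXz u (n : int) : unit_of F u -> unit_of F (u ^ n).
Proof.
by move=> Uu; case: n => n; [exact: unit_ofX | apply: unit_ofV; exact: unit_ofX].
Qed.

Lemma unit_of_sqrt s : F s -> unit_of F (s ^+ 2) -> unit_of F s.
Proof.
move=> Fs [_ [As [s0 As']]]; split=> //; split; first exact: Aint_sqrt.
split; first by move: s0; rewrite expf_eq0.
by apply: Aint_sqrt; rewrite exprVn.
Qed.
End Unit.

Lemma unit_of_sub (F G : algC -> Prop) u :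
  (forall z, F z -> G z) -> unit_of F u -> unit_of G u.
Proof. by move=> sFG [/sFG Gu Uu]. Qed.

Lemma rat_unit_pm1 (z : algC) : z \in Crat -> z \in Aint -> z^-1 \in Aint -> z != 0 ->
  z = 1 \/ z = -1.
Proof.
move=> Qz Az Az' z0.
have /intrP[a Da] := Cint_rat_Aint Qz Az.
have /intrP[b Db] := Cint_rat_Aint (rpredVr Qz) Az'.
have : a * b = 1 by apply: (@intr_inj algC); rewrite intrM -Da -Db mulfV.
rewrite mulrC => /intUnitRing.unitzPl/orP[]/eqP a1; rewrite Da a1; [left|right] => //.
Qed.

(** * The fields K+ and K *)

Section Biquadratic.
Variables (m : nat) (sg2 sgm : {rmorphism algC -> algC}).
Hypothesis m_gt0 : (0 < m)%N.
Hypotheses (sg2_2 : sg2 (rt 2) = - rt 2) (sg2_m : sg2 (rt m) = rt m) (sg2_i : sg2 ii = ii).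
Hypotheses (sgm_2 : sgm (rt 2) = rt 2) (sgm_m : sgm (rt m) = - rt m) (sgm_i : sgm ii = ii).

Local Notation r := (rt 2).
Local Notation s := (rt m).
Local Notation Kp := (Kplus m).
Local Notation Kf := (Kfull m).

Lemma Kp_def z : Kp z <->
  exists a b c e : rat, z = ratr a + ratr b * r + ratr c * s + ratr e * (r * s).
Proof. by []. Qed.

Lemma Qsqrt_def d z : Qsqrt d z <-> exists a b : rat, z = ratr a + ratr b * rt d.
Proof. by []. Qed.

Lemma Kp_rat (q : rat) : Kp (ratr q).
Proof. by apply/Kp_def; exists q, 0, 0, 0; rewrite !rmorph0; ring. Qed.

Lemma Kp1 : Kp 1. Proof. by have := Kp_rat 1; rewrite rmorph1. Qed.

Lemma Kp_2 : Kp r.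
Proof. by apply/Kp_def; exists 0, 1, 0, 0; rewrite !rmorph0 rmorph1; ring. Qed.

Lemma Kp_m : Kp s.
Proof. by apply/Kp_def; exists 0, 0, 1, 0; rewrite !rmorph0 rmorph1; ring. Qed.

Lemma KpD u v : Kp u -> Kp v -> Kp (u + v).
Proof.
move=> /Kp_def[a [b [c [e ->]]]] /Kp_def[a' [b' [c' [e' ->]]]]; apply/Kp_def.
by exists (a + a'), (b + b'), (c + c'), (e + e'); rewrite !rmorphD /=; ring.
Qed.

Lemma KpN u : Kp u -> Kp (- u).
Proof.
move=> /Kp_def[a [b [c [e ->]]]]; apply/Kp_def.
by exists (- a), (- b), (- c), (- e); rewrite !rmorphN /=; ring.
Qed.

Lemma KpM u v : Kp u -> Kp v -> Kp (u * v).
Proof.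
move=> /Kp_def[a [b [c [e ->]]]] /Kp_def[a' [b' [c' [e' ->]]]]; apply/Kp_def.
move: (rt_sqr 2) (rt_sqr m); set q2 : rat := 2%:R; set qm : rat := m%:R.
move: q2 qm => q2 qm r2 s2.
exists (a * a' + q2 * b * b' + qm * (c * c' + q2 * e * e')),
  (a * b' + b * a' + qm * (c * e' + e * c')),
  (a * c' + c * a' + q2 * (b * e' + e * b')), (a * e' + b * c' + c * b' + e * a').
by rewrite !(rmorphD, rmorphM) /= -r2 -s2; ring.
Qed.

Lemma sg2E a b c e : sg2 (ratr a + ratr b * r + ratr c * s + ratr e * (r * s)) =
  ratr a - ratr b * r + ratr c * s - ratr e * (r * s).
Proof. by rewrite !(fmorph_rat, rmorphD, rmorphM) /= sg2_2 sg2_m; ring. Qed.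

Lemma sgmE a b c e : sgm (ratr a + ratr b * r + ratr c * s + ratr e * (r * s)) =
  ratr a + ratr b * r - ratr c * s - ratr e * (r * s).
Proof. by rewrite !(fmorph_rat, rmorphD, rmorphM) /= sgm_2 sgm_m; ring. Qed.

Lemma Kp_sg2 u : Kp u -> Kp (sg2 u).
Proof.
move=> /Kp_def[a [b [c [e ->]]]]; rewrite sg2E; apply/Kp_def.
by exists a, (- b), c, (- e); rewrite !rmorphN /=; ring.
Qed.

Lemma Kp_sgm u : Kp u -> Kp (sgm u).
Proof.
move=> /Kp_def[a [b [c [e ->]]]]; rewrite sgmE; apply/Kp_def.
by exists a, b, (- c), (- e); rewrite !rmorphN /=; ring.
Qed.

(** Only the values of [sg2] at the generators are prescribed; elsewhere in [algC] it need not be an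
    involution. *)
Lemma sg2K u : Kp u -> sg2 (sg2 u) = u.
Proof.
move=> /Kp_def[a [b [c [e ->]]]].
by rewrite !(fmorph_rat, rmorphD, rmorphM, sg2_2, sg2_m, rmorphN) /=; ring.
Qed.

Lemma sgmK u : Kp u -> sgm (sgm u) = u.
Proof.
move=> /Kp_def[a [b [c [e ->]]]].
by rewrite !(fmorph_rat, rmorphD, rmorphM, sgm_2, sgm_m, rmorphN) /=; ring.
Qed.

Lemma sgC u : Kp u -> sg2 (sgm u) = sgm (sg2 u).
Proof.
move=> /Kp_def[a [b [c [e ->]]]].
by rewrite !(fmorph_rat, rmorphD, rmorphM, sg2_2, sg2_m, sgm_2, sgm_m, rmorphN) /=; ring.
Qed.

Lemma Kp_conj u : Kp u -> u^* = u.
Proof.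
move=> /Kp_def[a [b [c [e ->]]]].
by rewrite !(fmorph_rat, rmorphD, rmorphM) /= !conj_rt.
Qed.

Lemma Kp_real u : Kp u -> u \is Num.real.
Proof. by move=> Ku; apply/CrealP; exact: Kp_conj. Qed.

Lemma rt_neq0 k : (0 < k)%N -> rt k != 0.
Proof. by move=> k0; rewrite gt_eqF ?rt_gt0. Qed.

Lemma eq_opp0 (u : algC) : u = - u -> u = 0.
Proof. by move/eqP; rewrite -addr_eq0 -mulr2n mulrn_eq0 => /eqP. Qed.

(** The part of [z] that [sgm] negates equals its own opposite, so it is zero as a number. The
    analogues below follow the same pattern. *)
Lemma fix_sgm z : Kp z -> sgm z = z -> Qsqrt 2 z.
Proof.
move=> /Kp_def[a [b [c [e ->]]]]; rewrite sgmE => E; apply/Qsqrt_def; exists a, b.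
have : ratr c * s + ratr e * (r * s) = 0 by apply: eq_opp0; apply: (eq_by_sub (esym E)); ring.
by move=> E'; rewrite -addrA E' addr0.
Qed.

Lemma fix_sg2 z : Kp z -> sg2 z = z -> Qsqrt m z.
Proof.
move=> /Kp_def[a [b [c [e ->]]]]; rewrite sg2E => E; apply/Qsqrt_def; exists a, c.
have E' : ratr b * r + ratr e * (r * s) = 0 by apply: eq_opp0; apply: (eq_by_sub (esym E)); ring.
by apply: (eq_by_sub E'); ring.
Qed.

Lemma fix_sg2m z : Kp z -> sg2 (sgm z) = z -> Qsqrt (2 * m) z.
Proof.
move=> /Kp_def[a [b [c [e ->]]]] E; apply/Qsqrt_def; exists a, e; rewrite rtM.
move: E; rewrite !(fmorph_rat, rmorphD, rmorphM, sg2_2, sg2_m, sgm_2, sgm_m, rmorphN) /= => E.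
have E' : ratr b * r + ratr c * s = 0 by apply: eq_opp0; apply: (eq_by_sub (esym E)); ring.
by apply: (eq_by_sub E'); ring.
Qed.

Lemma neg_sg2 z : Kp z -> sg2 z = - z -> exists2 t, Qsqrt m t & z = r * t.
Proof.
move=> /Kp_def[a [b [c [e ->]]]]; rewrite sg2E => E.
exists (ratr b + ratr e * s); first by apply/Qsqrt_def; exists b, e.
have E' : ratr a + ratr c * s = 0 by apply: eq_opp0; apply: (eq_by_sub E); ring.
by apply: (eq_by_sub E'); ring.
Qed.

Lemma neg_sg2m z : Kp z -> sg2 (sgm z) = - z -> exists2 t, Qsqrt (2 * m) t & z = r * t.
Proof.
move=> /Kp_def[a [b [c [e ->]]]].
rewrite !(fmorph_rat, rmorphD, rmorphM, sg2_2, sg2_m, sgm_2, sgm_m, rmorphN) /= => E.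
(* Here [sqrt m] is rewritten as [sqrt 2] times half of [sqrt (2 m)]. *)
exists (ratr b + ratr (c / 2%:R) * (r * s)).
  by apply/Qsqrt_def; exists b, (c / 2%:R); rewrite rtM.
have E' : ratr a + ratr e * (r * s) = 0 by apply: eq_opp0; apply: (eq_by_sub E); ring.
have Dc : ratr c = ratr (c / 2%:R) * r ^+ 2 by rewrite rt_sqr -(rmorphM ratr) divfK.
by apply: (eq_by_sub E'); rewrite Dc; ring.
Qed.

Lemma Qsqrt2_Kp z : Qsqrt 2 z -> Kp z.
Proof. by move=> /Qsqrt_def[a [b ->]]; apply/KpD/KpM/Kp_2; exact: Kp_rat. Qed.

Lemma Qsqrtm_Kp z : Qsqrt m z -> Kp z.
Proof. by move=> /Qsqrt_def[a [b ->]]; apply/KpD/KpM/Kp_m; exact: Kp_rat. Qed.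

Lemma Qsqrt2m_Kp z : Qsqrt (2 * m) z -> Kp z.
Proof.
move=> /Qsqrt_def[a [b ->]]; rewrite rtM; apply/KpD/KpM/KpM/Kp_m/Kp_2; exact: Kp_rat.
Qed.

Lemma sgm_Qsqrt2 z : Qsqrt 2 z -> sgm z = z.
Proof.
by move=> /Qsqrt_def[a [b ->]]; rewrite !(fmorph_rat, rmorphD, rmorphM) /= sgm_2.
Qed.

Lemma sg2_Qsqrtm z : Qsqrt m z -> sg2 z = z.
Proof.
by move=> /Qsqrt_def[a [b ->]]; rewrite !(fmorph_rat, rmorphD, rmorphM) /= sg2_m.
Qed.

Lemma sg2_Qsqrt2m z : Qsqrt (2 * m) z -> sg2 z = sgm z.
Proof.
move=> /Qsqrt_def[a [b ->]].
by rewrite rtM !(fmorph_rat, rmorphD, rmorphM) /= sg2_m sg2_2 sgm_2 sgm_m; ring.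
Qed.

Lemma fix_rat z : Kp z -> sg2 z = z -> sgm z = z -> exists q : rat, z = ratr q.
Proof.
move=> Kz /(fix_sg2 Kz)/Qsqrt_def[a [b ->]] E; exists a.
move: E; rewrite !(fmorph_rat, rmorphD, rmorphM) /= sgm_m => E.
have -> : ratr b * s = 0 by apply: eq_opp0; apply: (eq_by_sub (esym E)); ring.
by rewrite addr0.
Qed.

(** The inverse of [z] is the product [w] of its three other conjugates divided by the norm [z w],
    which is rational because both automorphisms fix it. *)
Lemma KpV z : Kp z -> Kp z^-1.
Proof.
move=> Kz; have [->|z0] := eqVneq z 0; first by rewrite invr0; have := Kp_rat 0; rewrite rmorph0.
have K2 := Kp_sg2 Kz; have Km := Kp_sgm Kz; have K2m := Kp_sg2 Km.
pose w := sg2 z * sgm z * sg2 (sgm z).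
have Kw : Kp w by rewrite /w; do 2!apply: KpM => //.
have [|||q Dq] := @fix_rat (z * w).
- exact: KpM.
- by rewrite /w !rmorphM /= !sg2K //; ring.
- by rewrite /w !rmorphM /= sgC // !sgmK // -sgC //; ring.
have w0 : w != 0 by rewrite !mulf_neq0 ?fmorph_eq0.
have -> : z^-1 = w * ratr q^-1 by rewrite fmorphV /= -Dq invfM mulrC mulfVK.
exact/KpM/Kp_rat.
Qed.

Lemma Kf_def z : Kf z <-> exists u v, Kp u /\ Kp v /\ z = u + ii * v.
Proof. by []. Qed.

Lemma Kp_Kf u : Kp u -> Kf u.
Proof.
move=> Ku; apply/Kf_def; exists u, 0; split=> //; split; last by rewrite mulr0 addr0.
by have := Kp_rat 0; rewrite rmorph0.
Qed.

Lemma Kf_i : Kf ii.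
Proof.
apply/Kf_def; exists 0, 1; split; first by have := Kp_rat 0; rewrite rmorph0.
by split; [exact: Kp1 | rewrite mulr1 add0r].
Qed.

Lemma KfM z w : Kf z -> Kf w -> Kf (z * w).
Proof.
move=> /Kf_def[u [v [Ku [Kv ->]]]] /Kf_def[u' [v' [Ku' [Kv' ->]]]]; apply/Kf_def.
exists (u * u' + - (v * v')), (u * v' + v * u'); split.
  by apply/KpD/KpN/KpM => //; exact: KpM.
split; first by apply/KpD/KpM => //; exact: KpM.
by have i2 := ii_sqr; ring: i2.
Qed.

Lemma Kf_conj z : Kf z -> Kf z^*.
Proof.
move=> /Kf_def[u [v [Ku [Kv ->]]]]; apply/Kf_def; exists u, (- v); split=> //.
split; first exact: KpN.
by rewrite rmorphD rmorphM /= conj_ii !Kp_conj //; ring.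
Qed.

Lemma Kf_fix_conj z : Kf z -> z^* = z -> Kp z.
Proof.
move=> /Kf_def[u [v [Ku [Kv ->]]]]; rewrite rmorphD rmorphM /= conj_ii !Kp_conj // => E.
have -> : ii * v = 0 by apply: eq_opp0; apply: (eq_by_sub (esym E)); ring.
by rewrite addr0.
Qed.

Lemma KfV z : Kf z -> Kf z^-1.
Proof.
move=> Kz; have [->|z0] := eqVneq z 0.
  by rewrite invr0; apply: Kp_Kf; have := Kp_rat 0; rewrite rmorph0.
have Kzz : Kp (z * z^*).
  by apply: Kf_fix_conj; [apply/KfM/Kf_conj | rewrite rmorphM /= conjCK mulrC].
have -> : z^-1 = z^* * (z * z^*)^-1 by rewrite invfM mulrC mulfVK // fmorph_eq0.
by apply: KfM; [exact: Kf_conj | exact/Kp_Kf/KpV].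
Qed.

Lemma Kf_sg2 z : Kf z -> Kf (sg2 z).
Proof.
move=> /Kf_def[u [v [Ku [Kv ->]]]]; apply/Kf_def; exists (sg2 u), (sg2 v).
by split; [|split]; rewrite ?rmorphD ?rmorphM ?sg2_i //; exact: Kp_sg2.
Qed.

Lemma Kf_sgm z : Kf z -> Kf (sgm z).
Proof.
move=> /Kf_def[u [v [Ku [Kv ->]]]]; apply/Kf_def; exists (sgm u), (sgm v).
by split; [|split]; rewrite ?rmorphD ?rmorphM ?sgm_i //; exact: Kp_sgm.
Qed.

Lemma sg2_conj z : Kf z -> sg2 z^* = (sg2 z)^*.
Proof.
move=> /Kf_def[u [v [Ku [Kv ->]]]]; have K2u := Kp_sg2 Ku; have K2v := Kp_sg2 Kv.
by rewrite !(rmorphD, rmorphM) /= sg2_i !conj_ii !Kp_conj // rmorphN sg2_i.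
Qed.

Lemma sgm_conj z : Kf z -> sgm z^* = (sgm z)^*.
Proof.
move=> /Kf_def[u [v [Ku [Kv ->]]]]; have K2u := Kp_sgm Ku; have K2v := Kp_sgm Kv.
by rewrite !(rmorphD, rmorphM) /= sgm_i !conj_ii !Kp_conj // rmorphN sgm_i.
Qed.

Lemma sg2Kf z : Kf z -> sg2 (sg2 z) = z.
Proof.
by move=> /Kf_def[u [v [Ku [Kv ->]]]]; rewrite !(rmorphD, rmorphM) /= !sg2_i !sg2K.
Qed.

Lemma sgmKf z : Kf z -> sgm (sgm z) = z.
Proof.
by move=> /Kf_def[u [v [Ku [Kv ->]]]]; rewrite !(rmorphD, rmorphM) /= !sgm_i !sgmK.
Qed.

Lemma sgCf z : Kf z -> sg2 (sgm z) = sgm (sg2 z).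
Proof.
by move=> /Kf_def[u [v [Ku [Kv ->]]]]; rewrite !(rmorphD, rmorphM) /= sg2_i !sgm_i sg2_i !sgC.
Qed.

(** * Norms to the quadratic subfields *)

Lemma expz_eq1 (e : algC) (a : int) : 1 < e -> e ^ a = 1 -> a = 0.
Proof.
move=> e1; have e0 : 0 <= e by apply: le_trans (ltW e1); exact: ler01.
have en n : e ^+ n.+1 <> 1 by move/eqP; rewrite pexpr_eq1 // gt_eqF.
case: a => [[|n]|n] //; first by move/en.
by move/(congr1 GRing.inv); rewrite invr1 invrK => /en.
Qed.

Lemma pm1_sqr (n : algC) : n = 1 \/ n = -1 -> n ^+ 2 = 1.
Proof. by case=> ->; rewrite ?sqrrN expr1n. Qed.

Lemma pm1_sqrz (n : algC) (a : int) : n = 1 \/ n = -1 -> (n ^ a) ^+ 2 = 1.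
Proof. by move/pm1_sqr => n2; rewrite exprnP exprz_exp mulrC -exprz_exp -exprnP n2 exp1rz. Qed.

Lemma int_even_or_odd (a : int) : exists q : int, a = 2 * q \/ a = 2 * q + 1.
Proof. by exists (a %/ 2)%Z; lia. Qed.

Lemma rat_sqr_int (q : rat) (n : int) : q ^+ 2 = n%:~R -> exists z : int, q = z%:~R.
Proof.
move=> Dq; have Aq : (ratr q : algC) \in Aint.
  by apply: Aint_sqrt; rewrite -rmorphXn /= Dq ratr_int Aint_int.
have /intrP[z Dz] := Cint_rat_Aint (Crat_rat q) Aq.
by exists z; apply: ratr_inj; rewrite Dz ratr_int.
Qed.

Lemma unit_fixed_pm1 u : unit_of Kp u -> sg2 u = u -> sgm u = u -> u = 1 \/ u = -1.
Proof.
move=> [Ku [Au [u0 Au']]] E2 Em; apply: rat_unit_pm1 => //.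
by have [q ->] := fix_rat Ku E2 Em; exact: Crat_rat.
Qed.

Lemma unit_aut (nu : {rmorphism algC -> algC}) u :
  (forall v, Kp v -> Kp (nu v)) -> unit_of Kp u -> unit_of Kp (nu u).
Proof.
move=> Knu [Ku [Au [u0 Au']]]; split; first exact: Knu.
by rewrite fmorph_eq0 -fmorphV !Aint_aut.
Qed.

Lemma unit_sg2 u : unit_of Kp u -> unit_of Kp (sg2 u).
Proof. exact/unit_aut/Kp_sg2. Qed.

Lemma unit_sgm u : unit_of Kp u -> unit_of Kp (sgm u).
Proof. exact/unit_aut/Kp_sgm. Qed.

Lemma unit_KpM u v : unit_of Kp u -> unit_of Kp v -> unit_of Kp (u * v).
Proof. exact/unit_ofM/KpM. Qed.

Lemma unit_Kp2 u : unit_of (Qsqrt 2) u -> unit_of Kp u.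
Proof. exact/unit_of_sub/Qsqrt2_Kp. Qed.

Lemma unit_Kpm u : unit_of (Qsqrt m) u -> unit_of Kp u.
Proof. exact/unit_of_sub/Qsqrtm_Kp. Qed.

Lemma unit_Kp2m u : unit_of (Qsqrt (2 * m)) u -> unit_of Kp u.
Proof. exact/unit_of_sub/Qsqrt2m_Kp. Qed.

Lemma norm_Q2 u : unit_of (Qsqrt 2) u -> u * sg2 u = 1 \/ u * sg2 u = -1.
Proof.
move=> Uu; have Ku := unit_Kp2 Uu; have Kpu := proj1 Ku; have Qu := sgm_Qsqrt2 (proj1 Uu).
apply: unit_fixed_pm1; first exact/unit_KpM/unit_sg2.
  by rewrite rmorphM sg2K // mulrC.
by rewrite rmorphM -sgC // Qu.
Qed.

Lemma norm_Qm u : unit_of (Qsqrt m) u -> u * sgm u = 1 \/ u * sgm u = -1.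
Proof.
move=> Uu; have Ku := unit_Kpm Uu; have Kpu := proj1 Ku; have Qu := sg2_Qsqrtm (proj1 Uu).
apply: unit_fixed_pm1; first exact/unit_KpM/unit_sgm.
  by rewrite rmorphM sgC // Qu.
by rewrite rmorphM sgmK // mulrC.
Qed.

Lemma norm_Q2m u : unit_of (Qsqrt (2 * m)) u -> u * sgm u = 1 \/ u * sgm u = -1.
Proof.
move=> Uu; have Ku := unit_Kp2m Uu; have Kpu := proj1 Ku; have Qu := sg2_Qsqrt2m (proj1 Uu).
apply: unit_fixed_pm1; first exact/unit_KpM/unit_sgm.
  by rewrite rmorphM sgC // Qu sgmK // mulrC.
by rewrite rmorphM sgmK // mulrC.
Qed.

Lemma normQ_m u (n : int) : normQ m u n -> u * sgm u = n%:~R.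
Proof.
move=> [a [b [-> E]]]; rewrite -/(rt m) !(fmorph_rat, rmorphD, rmorphM) /= sgm_m.
by rewrite -(ratr_int algC) -E !(rmorphB, rmorphM, rmorphXn) /= -rt_sqr; ring.
Qed.

(** * Units of Q(sqrt m) are not twice squares *)

Hypothesis m_mod4 : (m %% 4 = 1)%N.

(* With [A = 2 A'] and [C = 2 C'] the two equations give [m A'^2 - C'^2 = 2 m d],
   impossible modulo 4. *)
Lemma no_mod4_solution (A C T d : int) : d = 1 \/ d = -1 ->
  A ^+ 2 = 4 * d + 2 * T -> C ^+ 2 = m%:Z * (2 * T - 4 * d) -> False.
Proof.
have [k Dm] : exists k : int, m%:Z = 4 * k + 1 by exists (m %/ 4)%N%:Z; lia.
rewrite Dm !expr2 => Dd EA EC.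
have [A' [DA|DA]] := int_even_or_odd A; last by subst A; lia.
have [C' DC] := int_even_or_odd C.
have {DC} DC : C = 2 * C' by case: DC => // DC; subst C; move: EA EC; rewrite DA; lia.
subst A C; have ET : T = 2 * A' * A' - 2 * d by lia.
have EC' : C' * C' = (4 * k + 1) * (A' * A' - 2 * d) by rewrite ET in EC; nia.
have [a Da] := int_even_or_odd A'; have [c Dc] := int_even_or_odd C'.
by case: Da Dc Dd => Da [] Dc [] Dd; subst A' C' d; nia.
Qed.

Lemma rt_sqr_nat k : rt k ^+ 2 = k%:R.
Proof. by rewrite rt_sqr ratr_nat. Qed.

Lemma normQ_2m u (n : int) : normQ (2 * m) u n -> u * sgm u = n%:~R.
Proof.
move=> [a [b [-> E]]]; rewrite -/(rt (2 * m)) !(fmorph_rat, rmorphD, rmorphM) /=.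
rewrite -(ratr_int algC) -E !(rmorphB, rmorphM, rmorphXn) /= -rt_sqr rtM rmorphM sgm_2 sgm_m.
by ring.
Qed.

(* For [t = a + b sqrt m], the integers [A = 4 a] and [C = 4 m b] have squares determined
   by [T = Tr v] and [d = 2 N(t)]. *)
Lemma unit_not_twice_sqr v t : unit_of (Qsqrt m) v -> Qsqrt m t -> v = 2 * t ^+ 2 -> False.
Proof.
move=> Uv /Qsqrt_def[a [b Dt]] Dv.
have Dnt : sgm t = ratr a - ratr b * s.
  by rewrite Dt !(fmorph_rat, rmorphD, rmorphM) /= sgm_m; ring.
have sgmv : sgm v = 2 * sgm t ^+ 2 by rewrite Dv rmorphM rmorphXn rmorph_nat.
have [T ET] : exists T : int, 4 * a ^+ 2 + 4 * m%:R * b ^+ 2 = T%:~R :> rat.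
  have Av : v + sgm v \in Aint.
    by case: Uv => _ [Av _]; rewrite rpredD ?Aint_aut.
  have Dq : v + sgm v = ratr (4 * a ^+ 2 + 4 * m%:R * b ^+ 2).
    rewrite sgmv Dv Dnt Dt !(ratr_nat, rmorphD, rmorphM, rmorphXn) /=.
    by have s2 := rt_sqr_nat m; ring: s2.
  have Qv : v + sgm v \in Crat by rewrite Dq Crat_rat.
  have /intrP[T DT] := Cint_rat_Aint Qv Av.
  by exists T; apply: ratr_inj; rewrite -Dq DT ratr_int.
(* The norm of the unit [v] is [(2 N(t))^2]; being nonnegative it is 1, so [2 N(t)] is 1 or -1. *)
have [d Dd Ed] : exists2 d : int, d = 1 \/ d = -1 & 2 * (a ^+ 2 - m%:R * b ^+ 2) = d%:~R :> rat.
  have E : v * sgm v = ratr ((2 * (a ^+ 2 - m%:R * b ^+ 2)) ^+ 2).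
    rewrite sgmv Dv Dnt Dt !(ratr_nat, rmorphB, rmorphM, rmorphXn) /=.
    by have s2 := rt_sqr_nat m; ring: s2.
  have E1 : (2 * (a ^+ 2 - m%:R * b ^+ 2)) ^+ 2 = 1.
    apply: ratr_inj; rewrite -E rmorph1; case: (norm_Qm Uv) => // E'.
    have := sqr_ge0 (2 * (a ^+ 2 - m%:R * b ^+ 2)); rewrite -(ler0q algC) -E E'.
    by rewrite oppr_ge0 ler10.
  move/eqP: E1; rewrite sqrf_eq1 => /orP[]/eqP->; [exists 1 | exists (-1)] => //; last by right.
  by left.
have [A DA] : exists A : int, 4 * a = A%:~R.
  apply: (@rat_sqr_int _ (4 * d + 2 * T)).
  by rewrite intrD !intrM -ET -Ed; ring.
have [C DC] : exists C : int, 4 * m%:R * b = C%:~R.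
  apply: (@rat_sqr_int _ (m%:Z * (2 * T - 4 * d))).
  by rewrite intrM intrB !intrM -ET -Ed; ring.
apply: (@no_mod4_solution A C T d) => //; apply: (@intr_inj rat).
  by rewrite rmorphXn /= -DA intrD !intrM -ET -Ed; ring.
by rewrite rmorphXn /= -DC intrM intrB !intrM -ET -Ed; ring.
Qed.

(** A root [t] would be [e^n] up to sign, giving [e^(2 n - 1) = 1] although [e > 1]. *)
Lemma fund_unit_not_sqr d e t : fund_unit d e -> unit_of (Qsqrt d) t -> t ^+ 2 = e -> False.
Proof.
move=> [_ e1 He] /He[n Dt] De.
have e0 : e != 0 by rewrite gt_eqF // (lt_trans _ e1) // ltr01.
have : e ^ (n + n) * e^-1 = 1.
  by rewrite expfzDr // -expr2 -[in e^-1]De; case: Dt => ->; rewrite ?sqrrN mulfV // expf_neq0 // expfz_neq0.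
rewrite -exprN1 -expfzDr // => /(expz_eq1 e1); lia.
Qed.

Lemma unit_Kp_sqrt u t : unit_of Kp u -> Kp t -> t ^+ 2 = u -> unit_of Kp t.
Proof. by move=> Uu Kt Dt; apply: unit_of_sqrt; rewrite ?Dt. Qed.

(** * Fundamental units and squares of units of K+ *)

Variables (e1 e2 e3 : algC).
Hypotheses (fe1 : fund_unit 2 e1) (fe2 : fund_unit m e2) (fe3 : fund_unit (2 * m) e3).

Lemma Ue1 : unit_of Kp e1. Proof. by case: fe1 => /unit_Kp2. Qed.
Lemma Ue2 : unit_of Kp e2. Proof. by case: fe2 => /unit_Kpm. Qed.
Lemma Ue3 : unit_of Kp e3. Proof. by case: fe3 => /unit_Kp2m. Qed.

Lemma e1_gt0 : 0 < e1. Proof. by case: fe1 => _ h _; apply: lt_trans h; exact: ltr01. Qed.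
Lemma e2_gt0 : 0 < e2. Proof. by case: fe2 => _ h _; apply: lt_trans h; exact: ltr01. Qed.
Lemma e3_gt0 : 0 < e3. Proof. by case: fe3 => _ h _; apply: lt_trans h; exact: ltr01. Qed.

(* [sg2] fixes [e2], so it maps [t] to [t] or [- t]: in the second case [t / sqrt 2] lies in
   Q(sqrt m) and [e2] is twice a square there. *)
Lemma e2_not_sqr t : Kp t -> t ^+ 2 = e2 -> False.
Proof.
move=> Kt Dt; have Ut := unit_Kp_sqrt Ue2 Kt Dt.
have Q2 : Qsqrt m e2 by case: fe2 => [[]].
have : sg2 t ^+ 2 == t ^+ 2 by rewrite -rmorphXn /= Dt sg2_Qsqrtm.
rewrite eqf_sqr => /orP[]/eqP E.
  apply: (fund_unit_not_sqr fe2 _ Dt); split; first exact: fix_sg2.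
  by case: Ut.
have [t' Qt' Dt'] := neg_sg2 Kt E.
apply: (@unit_not_twice_sqr e2 t') => //; first by case: fe2.
by rewrite -Dt Dt' exprMn rt_sqr_nat.
Qed.

(* [1 + sqrt 2] is a unit of norm -1. *)
Lemma norm_e1 : e1 * sg2 e1 = -1.
Proof.
have Ur : unit_of (Qsqrt 2) (1 + r).
  have rr : r ^+ 2 = 2 by rewrite rt_sqr_nat.
  have Ar : r \in Aint by apply: Aint_sqrt; rewrite rr; exact: (Aint_int 2).
  have E : (1 + r) * (r - 1) = 1 by apply: (eq_by_sub rr); ring.
  have r0 : 1 + r != 0 by apply/eqP => r0; move/eqP: E; rewrite r0 mul0r eq_sym oner_eq0.
  split; first by apply/Qsqrt_def; exists 1, 1; rewrite rmorph1 mul1r.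
  split; first by rewrite rpredD ?Aint1.
  split=> //; have -> : (1 + r)^-1 = r - 1 by apply: (mulfI r0); rewrite mulfV.
  by rewrite rpredB ?Aint1.
have Nr : (1 + r) * sg2 (1 + r) = -1.
  by rewrite rmorphD rmorph1 /= sg2_2; apply: (eq_by_sub (esym (rt_sqr_nat 2))); ring.
(* If [e1] had norm 1, so would every unit of Q(sqrt 2), including [1 + sqrt 2]. *)
case: (fe1) => U1 _ /(_ _ Ur)[n Dn]; case: (norm_Q2 U1) => // N1.
have : e1 ^ n * sg2 (e1 ^ n) = -1.
  by rewrite -Nr; case: Dn => ->; rewrite ?rmorphN ?mulrNN.
have e10 := unit_of_neq0 Ue1.
rewrite fmorphXz -exprzMl ?unitfE ?fmorph_eq0 // N1 exp1rz => /eqP.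
by rewrite -addr_eq0 -mulr2n pnatr_eq0.
Qed.

(* The product of [u sgm(u)], [u sg2(u)] and [u sg2(sgm(u))] is [u^2] times the norm of the last. *)
Lemma unit_sqr u : unit_of Kp u -> exists a b c : int, u ^+ 2 = e1 ^ a * e2 ^ b * e3 ^ c.
Proof.
move=> Uu; have Ku := proj1 Uu; have u0 := unit_of_neq0 Uu.
have [Km K2] := (Kp_sgm Ku, Kp_sg2 Ku); have K2m := Kp_sg2 Km.
have Um := unit_sgm Uu; have U2 := unit_sg2 Uu; have U2m := unit_sg2 Um.
have U1 : unit_of (Qsqrt 2) (u * sgm u).
  have [KN ?] := unit_KpM Uu Um; split=> //; apply: fix_sgm => //.
  by rewrite rmorphM sgmK // mulrC.
have Uq2 : unit_of (Qsqrt m) (u * sg2 u).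
  have [KN ?] := unit_KpM Uu U2; split=> //; apply: fix_sg2 => //.
  by rewrite rmorphM sg2K // mulrC.
have U3 : unit_of (Qsqrt (2 * m)) (u * sg2 (sgm u)).
  have [KN ?] := unit_KpM Uu U2m; split=> //; apply: fix_sg2m => //.
  by rewrite !rmorphM /= (sgC Ku) sgmK // sg2K // mulrC.
have [a Da] : exists a, u * sgm u = e1 ^ a \/ u * sgm u = - e1 ^ a by case: fe1 => _ _ /(_ _ U1).
have [b Db] : exists b, u * sg2 u = e2 ^ b \/ u * sg2 u = - e2 ^ b by case: fe2 => _ _ /(_ _ Uq2).
have [c Dc] : exists c, u * sg2 (sgm u) = e3 ^ c \/ u * sg2 (sgm u) = - e3 ^ c
  by case: fe3 => _ _ /(_ _ U3).
have N3 : u * sg2 (sgm u) * (sg2 u * sgm u) = 1 \/ u * sg2 (sgm u) * (sg2 u * sgm u) = -1.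
  have := norm_Q2m U3; rewrite -(sg2_Qsqrt2m (proj1 U3)) rmorphM sg2K //.
exists a, b, c; set w := RHS.
(* Both [w] and [u^2] are positive, K+ being real; this settles the sign that the norms leave
   open. *)
have w_gt0 : 0 < w by rewrite !mulr_gt0 ?exprz_gt0 ?e1_gt0 ?e2_gt0 ?e3_gt0.
have u_gt0 : 0 < u ^+ 2.
  by rewrite real_exprn_even_gt0 ?Kp_real.
have : u ^+ 2 = w \/ u ^+ 2 = - w.
  have : (u * sgm u) * (u * sg2 u) * (u * sg2 (sgm u)) = w \/
    (u * sgm u) * (u * sg2 u) * (u * sg2 (sgm u)) = - w.
    rewrite /w; case: Da => ->; case: Db => ->; case: Dc => ->; rewrite ?(mulrN, mulNr, opprK); tauto.
  have -> : (u * sgm u) * (u * sg2 u) * (u * sg2 (sgm u)) =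
    u ^+ 2 * (u * sg2 (sgm u) * (sg2 u * sgm u)) by ring.
  case: N3 => ->; rewrite ?mulrN mulr1 => -[] Eu; [by left | by right | |].
    by right; rewrite -Eu opprK.
  by left; apply: oppr_inj.
case=> // E; move: u_gt0; rewrite E oppr_gt0 => /lt_trans/(_ w_gt0).
by rewrite ltxx.
Qed.

(** * Fundamental systems from square classes *)

Lemma unit_monom (f1 f2 f3 : algC) (a b c : int) :
  unit_of Kp f1 -> unit_of Kp f2 -> unit_of Kp f3 -> unit_of Kp (f1 ^ a * f2 ^ b * f3 ^ c).
Proof.
move=> U1 U2 U3; have UX u n : unit_of Kp u -> unit_of Kp (u ^ n).
  by apply: unit_ofXz; [exact: KpM | exact: KpV | exact: Kp1].
by apply: unit_KpM; [apply: unit_KpM|]; exact: UX.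
Qed.

Lemma int_parity (a : int) : exists (q : int) (b : bool), a = q + q + b%:Z.
Proof.
by have [q [->|->]] := int_even_or_odd a; [exists q, false | exists q, true]; lia.
Qed.

(** The exponents in the expression of [u^2] are halved: the integer halves form a monomial, and the
    parities [i], [j], [k] give the square of the remaining factor [t]. *)
Lemma unit_decomp u : unit_of Kp u -> exists (a b c : int) (i j k : bool) (t : algC),
  [/\ Kp t, u = t * (e1 ^ a * e2 ^ b * e3 ^ c) & t ^+ 2 = e1 ^+ i * e2 ^+ j * e3 ^+ k].
Proof.
move=> Uu; have [a [b [c E]]] := unit_sqr Uu.
have [a' [i Da]] := int_parity a; have [b' [j Db]] := int_parity b.
have [c' [k Dc]] := int_parity c.
have Uw := unit_monom a' b' c' Ue1 Ue2 Ue3; set w := _ * _ * _ in Uw.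
exists a', b', c', i, j, k, (u * w^-1); split.
- by apply: KpM; [case: Uu | apply: KpV; case: Uw].
- by rewrite -/w mulfVK //; exact: unit_of_neq0 Uw.
have [n1 n2 n3] := And3 (unit_of_neq0 Ue1) (unit_of_neq0 Ue2) (unit_of_neq0 Ue3).
have n0 := unit_of_neq0 Uw; rewrite exprMn exprVn E.
apply: (canLR (mulfK _)); first by rewrite expf_neq0.
rewrite Da Db Dc !(expfzDr, n1, n2, n3) // -!exprnP /w; ring.
Qed.

(* Unqualified, [root_of_unity] is the predicate of mathcomp's poly. *)
Lemma real_root_of_unity_eq1 (z : algC) : 0 < z -> Defs.root_of_unity z -> z = 1.
Proof.
by move=> z0 [n [n0 /eqP]]; rewrite pexpr_eq1 ?ltW // => /eqP.
Qed.

(** The monomial is positive, so as a root of unity it equals 1. Its norm to each quadratic subfield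
    is the square of a power of one fundamental unit, up to sign, and this forces each exponent to
    vanish. *)
Lemma monom_indep (a b c : int) :
  Defs.root_of_unity (e1 ^ a * e2 ^ b * e3 ^ c) -> [/\ a = 0, b = 0 & c = 0].
Proof.
move/real_root_of_unity_eq1 => E1.
have {E1} E : e1 ^ a * e2 ^ b * e3 ^ c = 1.
  by apply: E1; rewrite !mulr_gt0 ?exprz_gt0 ?e1_gt0 ?e2_gt0 ?e3_gt0.
have X2 (f x y z : algC) (n : int) : 1 < f ->
    x ^+ 2 = 1 -> y ^+ 2 = 1 -> (f ^ n * f ^ n) * x * y = 1 -> n = 0.
  move=> f1 x2 y2 Ef; have f0 : f != 0 by rewrite gt_eqF // (lt_trans _ f1) // ltr01.
  have := congr1 (fun z => z ^+ 2) Ef; rewrite /= !exprMn x2 y2 !mulr1 expr1n.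
  rewrite !exprnP !exprz_exp -expfzDr // => /(expz_eq1 f1); lia.
have pm := pm1_sqrz.
have [n1 n2 n3] := And3 (unit_of_neq0 Ue1) (unit_of_neq0 Ue2) (unit_of_neq0 Ue3).
have Mz f n : f != 0 -> forall nu : {rmorphism algC -> algC}, f ^ n * nu f ^ n = (f * nu f) ^ n.
  by move=> f0 nu; rewrite exprzMl ?unitfE ?fmorph_eq0.
have [U1 g1 _] := fe1; have [U2 g2 _] := fe2; have [U3 g3 _] := fe3.
have Emul (nu : {rmorphism algC -> algC}) :
    e1 ^ a * e2 ^ b * e3 ^ c * nu (e1 ^ a * e2 ^ b * e3 ^ c) = 1.
  by rewrite E rmorph1 mulr1.
split.
- apply: (X2 e1 ((e2 * sgm e2) ^ b) ((e3 * sgm e3) ^ c)) => //.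
  + exact/pm/norm_Qm.
  + exact/pm/norm_Q2m.
  rewrite -!Mz // -(Emul sgm) !rmorphM !fmorphXz /= (sgm_Qsqrt2 (proj1 U1)); ring.
- apply: (X2 e2 ((e1 * sg2 e1) ^ a) ((e3 * sg2 e3) ^ c)) => //.
  + exact/pm/norm_Q2.
  + by apply: pm; rewrite (sg2_Qsqrt2m (proj1 U3)); exact: norm_Q2m.
  rewrite -!Mz // -(Emul sg2) !rmorphM !fmorphXz /= (sg2_Qsqrtm (proj1 U2)); ring.
- apply: (X2 e3 ((e1 * sg2 e1) ^ a) ((e2 * sgm e2) ^ b)) => //.
  + exact/pm/norm_Q2.
  + exact/pm/norm_Qm.
  rewrite -!Mz // -(Emul (sg2 \o sgm)) /=.
  rewrite !rmorphM !fmorphXz /= (sgm_Qsqrt2 (proj1 U1)).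
  have K2 : Kp (sgm e2) by apply: Kp_sgm; case: Ue2.
  have Q2 : sg2 (sgm e2) = sgm e2 by rewrite sgC ?(sg2_Qsqrtm (proj1 U2)) //; case: Ue2.
  have Q3 : sg2 (sgm e3) = e3.
    by rewrite -(sg2_Qsqrt2m (proj1 U3)) sg2K //; case: Ue3.
  rewrite Q2 Q3; ring.
Qed.

Lemma pm1_root_of_unity (w : algC) : w = 1 \/ w = -1 -> Defs.root_of_unity w.
Proof. by move=> Ew; exists 2; split=> //; exact: pm1_sqr. Qed.

Lemma Kp_pm1 (w : algC) : w = 1 \/ w = -1 -> Kp w.
Proof. by case=> ->; [|apply: KpN]; exact: Kp1. Qed.

Lemma sqr_eq_pm1 (t u : algC) : t ^+ 2 = u ^+ 2 -> exists2 w, w = 1 \/ w = -1 & t = w * u.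
Proof.
move/eqP; rewrite eqf_sqr => /orP[]/eqP->; [exists 1 | exists (-1)]; rewrite ?mulN1r ?mul1r //.
  by left.
by right.
Qed.

(** If no nontrivial product is a square, the factor [t] in the decomposition of a unit has square
    1. *)
Lemma FSU_Kp_trivial :
  (forall (i j k : bool) t, Kp t -> t ^+ 2 = e1 ^+ i * e2 ^+ j * e3 ^+ k -> [/\ ~~ i, ~~ j & ~~ k]) ->
  FSU Kp e1 e2 e3.
Proof.
move=> H; split; [exact: Ue1 | exact: Ue2 | exact: Ue3 | | exact: monom_indep].
move=> u /unit_decomp[a [b [c [i [j [k [t [Kt Du]]]]]]]] Dt.
have [/negbTE i0 /negbTE j0 /negbTE k0] := H _ _ _ _ Kt Dt.
have Et : t = 1 \/ t = -1.
  have [|w Ew ->] := @sqr_eq_pm1 t 1; last by rewrite mulr1.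
  by rewrite Dt i0 j0 k0 !expr0 !mulr1 expr1n.
by exists t, a, b, c; split=> //; split=> //; exact: pm1_root_of_unity.
Qed.

(** The only nontrivial square among the products is [w = e1^i0 e2^j0 e3], so the factor [t] of a
    unit is 1 or [sqrt w] up to sign. As [e3] occurs once in [w], it is a monomial in [e1], [e2] and
    [sqrt w]. *)
Lemma FSU_Kp_sqrt (i0 j0 : bool) t0 :
  Kp t0 -> t0 ^+ 2 = e1 ^+ i0 * e2 ^+ j0 * e3 ->
  (forall (i j k : bool) t, Kp t -> t ^+ 2 = e1 ^+ i * e2 ^+ j * e3 ^+ k ->
     [/\ ~~ i, ~~ j & ~~ k] \/ [/\ i = i0, j = j0 & k]) ->
  FSU Kp e1 e2 (sqrtC (e1 ^+ i0 * e2 ^+ j0 * e3)).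
Proof.
move=> Kt0 Dt0 H; set w := _ * e3; set q := sqrtC w.
have q2 : q ^+ 2 = w by rewrite sqrtCK.
(* The root picked by [sqrtC] is [t0] or [- t0]. *)
have Kq : Kp q.
  have [|x Ex ->] := @sqr_eq_pm1 q t0; first by rewrite q2.
  by apply: KpM => //; exact: Kp_pm1.
have Uw : unit_of Kp w.
  have := unit_monom i0 j0 1 Ue1 Ue2 Ue3; by rewrite -!exprnP expr1.
have Uq : unit_of Kp q by apply: unit_Kp_sqrt q2.
have [n1 n2 n3] := And3 (unit_of_neq0 Ue1) (unit_of_neq0 Ue2) (unit_of_neq0 Ue3).
have q0 := unit_of_neq0 Uq.
split; [exact: Ue1 | exact: Ue2 | exact: Uq | | ].
  move=> u /unit_decomp[a [b [c [i [j [k [t [Kt Du]]]]]]]] Dt.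
  have E3 : e3 = q ^ 2%:Z * (e1 ^ (- i0%:Z) * e2 ^ (- j0%:Z)).
    rewrite -exprnP q2 /w -!invr_expz -!exprnP mulrC !mulrA.
    by field; rewrite !expf_neq0.
  have E3c : e3 ^ c = q ^ (c + c) * (e1 ^ (- i0%:Z * c) * e2 ^ (- j0%:Z * c)).
    by rewrite {1}E3 !exprzMl ?unitfE ?mulf_neq0 ?expfz_neq0 // !exprz_exp; rewrite expfzDr.
  have [d [x Ex Dtx]] : exists d : int, exists2 x, x = 1 \/ x = -1 & t = x * q ^ d.
    have [[/negbTE i1 /negbTE j1 /negbTE k1]|[i1 j1 k1]] := H _ _ _ _ Kt Dt.
      by exists (Posz 0); apply: sqr_eq_pm1; rewrite Dt i1 j1 k1 !expr0 expr0z !mulr1 expr1n.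
    by exists (Posz 1); apply: sqr_eq_pm1; rewrite Dt i1 j1 k1 expr1z q2.
  exists x, (a - i0%:Z * c), (b - j0%:Z * c), (c + c + d); split; first exact: Kp_pm1.
  split; first exact: pm1_root_of_unity.
  rewrite Du Dtx E3c !expfzDr // !mulNr; ring.
move=> a b c [n [n_gt0 En]].
(* Squaring replaces [q^c] by [w^c] and yields a relation between [e1], [e2] and [e3]. *)
have /monom_indep[] : Defs.root_of_unity (e1 ^ (a + a + i0%:Z * c) * e2 ^ (b + b + j0%:Z * c) * e3 ^ c).
  exists n; split=> //.
  have -> : e1 ^ (a + a + i0%:Z * c) * e2 ^ (b + b + j0%:Z * c) * e3 ^ c =
     (e1 ^ a * e2 ^ b * q ^ c) ^+ 2.
    rewrite exprMn; have -> : (q ^ c) ^+ 2 = w ^ c.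
      by rewrite exprnP exprz_exp mulrC -exprz_exp -exprnP q2.
    rewrite /w !exprzMl ?unitfE ?mulf_neq0 ?expf_neq0 // !expfzDr // -!exprz_exp -!exprnP; ring.
  by rewrite exprAC En expr1n.
by move=> A B C; split; nia.
Qed.

(** A unit of K is a root of unity times a unit of K+, and the root is absorbed into the torsion
    factor. *)
Lemma FSU_Kf f1 f2 f3 : hasse_index_one Kf Kp -> FSU Kp f1 f2 f3 -> FSU Kf f1 f2 f3.
Proof.
move=> Q [U1 U2 U3 gen ind].
split=> //; [exact: (unit_of_sub Kp_Kf U1) | exact: (unit_of_sub Kp_Kf U2) | exact: (unit_of_sub Kp_Kf U3) |].
move=> u /Q[w [v [Kw [[n [n0 wn]] [Uv ->]]]]].
have [w' [a [b [c [Kw' [[n' [n0' wn']] ->]]]]]] := gen _ Uv.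
exists (w * w'), a, b, c; split; first by apply: KfM => //; exact: Kp_Kf.
split; last by rewrite mulrA.
exists (n * n')%N; rewrite muln_gt0 n0; split=> //.
by rewrite exprMn exprM wn expr1n mulnC exprM wn' expr1n mulr1.
Qed.

(** * Hasse's unit index *)

Lemma unit_KfM u v : unit_of Kf u -> unit_of Kf v -> unit_of Kf (u * v).
Proof. exact/unit_ofM/KfM. Qed.

Lemma unit_conj u : unit_of Kf u -> unit_of Kf u^*.
Proof.
move=> [Ku [Au [u0 Au']]]; split; first exact: Kf_conj.
by rewrite fmorph_eq0 -fmorphV !Aint_aut.
Qed.

Lemma unit_Kf_sg2 u : unit_of Kf u -> unit_of Kf (sg2 u).
Proof.
move=> [Ku [Au [u0 Au']]]; split; first exact: Kf_sg2.
by rewrite fmorph_eq0 -fmorphV !Aint_aut.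
Qed.

Lemma unit_Kf_sgm u : unit_of Kf u -> unit_of Kf (sgm u).
Proof.
move=> [Ku [Au [u0 Au']]]; split; first exact: Kf_sgm.
by rewrite fmorph_eq0 -fmorphV !Aint_aut.
Qed.

Lemma unit_Kf_fix u : unit_of Kf u -> u^* = u -> unit_of Kp u.
Proof. by move=> [Ku Hu] E; split=> //; exact: Kf_fix_conj. Qed.

(** Since [n] has absolute value 1, its trace [k] lies between -2 and 2, and the roots of
    [X^2 - k X + 1] then have order 1, 2, 3, 4 or 6. *)
Lemma norm1_int_trace (n : algC) (k : int) :
  n * n^* = 1 -> n + n^* = k%:~R -> n ^+ 12 = 1.
Proof.
move=> N1 Tk; have abs_n : `|n| = 1.
  by apply/eqP; rewrite -(@pexpr_eq1 _ _ 2) // normCK N1.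
have abs_k : `|k| <= 2.
  rewrite -(ler_int algC) intr_norm -Tk (le_trans (ler_normD _ _)) //.
  by rewrite norm_conjC abs_n.
have E : n ^+ 2 = k%:~R * n - 1 by rewrite -Tk -N1; ring.
have E3 : n ^+ 3 = (k%:~R ^+ 2 - 1) * n - k%:~R by ring: E.
have [] : k = 2 \/ k = -2 \/ k = 0 \/ k = 1 \/ k = -1 by lia.
- move=> Dk; have /eqP : (n - 1) ^+ 2 = 0 by rewrite sqrrB expr1n mulr1 E Dk; ring.
  by rewrite expf_eq0 subr_eq0 => /eqP->; rewrite expr1n.
case=> [Dk|].
  have /eqP : (n + 1) ^+ 2 = 0 by rewrite sqrrD expr1n mulr1 E Dk; ring.
  by rewrite expf_eq0 addr_eq0 => /eqP->; rewrite -signr_odd.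
case=> [Dk|].
  by rewrite (exprM n 2 6) E Dk mul0r add0r -signr_odd.
case=> Dk; rewrite (exprM n 3 4).
  have -> : n ^+ 3 = -1 by rewrite E3 Dk; ring.
  by rewrite -signr_odd.
have -> : n ^+ 3 = 1 by rewrite E3 Dk; ring.
by rewrite expr1n.
Qed.

(* The hypotheses say that [n] lies in one of the four imaginary quadratic subfields. *)
Lemma imag_unit_order n : unit_of Kf n ->
  sg2 n = n \/ sg2 n = n^* -> sgm n = n \/ sgm n = n^* -> n * n^* = 1 /\ n ^+ 12 = 1.
Proof.
move=> Un E2 Em; have Kn := proj1 Un; have [Uc Kc] := (unit_conj Un, Kf_conj Kn).
(* Both automorphisms fix this unit of K+, so it is 1 or -1, and it is positive. *)
have N1 : n * n^* = 1.
  have Kd : unit_of Kp (n * n^*).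
    by apply: unit_Kf_fix; [exact: unit_KfM | rewrite rmorphM /= conjCK mulrC].
  have d_gt0 : 0 < n * n^* by rewrite mul_conjC_gt0 (unit_of_neq0 Un).
  have [||//|E] := unit_fixed_pm1 Kd.
  - by rewrite rmorphM /= sg2_conj //; case: E2 => ->; rewrite ?conjCK // mulrC.
  - by rewrite rmorphM /= sgm_conj //; case: Em => ->; rewrite ?conjCK // mulrC.
  by move: d_gt0; rewrite E oppr_gt0 ltr10.
split=> //.
have Kt : Kp (n + n^*).
  apply: Kf_fix_conj; last by rewrite rmorphD /= conjCK addrC.
  move: Kn => /Kf_def[u [v [Ku [Kv ->]]]]; rewrite rmorphD rmorphM /= conj_ii !Kp_conj //.
  by have -> : u + ii * v + (u + - ii * v) = u + u by [ring]; apply/Kp_Kf/KpD.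
have [||q Dq] := fix_rat Kt.
- by rewrite rmorphD /= sg2_conj //; case: E2 => ->; rewrite ?conjCK // addrC.
- by rewrite rmorphD /= sgm_conj //; case: Em => ->; rewrite ?conjCK // addrC.
have At : n + n^* \in Aint by rewrite rpredD ?Aint_aut //; case: Un => _ [].
have Qt : n + n^* \in Crat by rewrite Dq Crat_rat.
by have /intrP[k Dk] := Cint_rat_Aint Qt At; exact: norm1_int_trace N1 Dk.
Qed.

(** The product [Z] of the four relative norms is [u^4] times a real number, and [Z conj(Z) = 1].
    Hence [(u / conj u)^4 = Z / conj(Z) = Z^2], while [Z^12 = 1]. *)
Lemma unit_over_conj_order u : unit_of Kf u -> (u / u^*) ^+ 24 = 1.
Proof.
move=> Uu; have Ku := proj1 Uu.
have [U2 Um] := (unit_Kf_sg2 Uu, unit_Kf_sgm Uu); have U2m := unit_Kf_sg2 Um.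
have [[K2 _] [Km _] [K2m _]] := And3 U2 Um U2m.
have [Uc U2c [Umc U2mc]] := And3 (unit_conj Uu) (unit_conj U2) (conj (unit_conj Um) (unit_conj U2m)).
have E22 : sg2 (sg2 u) = u by rewrite sg2Kf.
have Em2 : sgm (sg2 u) = sg2 (sgm u) by rewrite sgCf.
have Emm : sgm (sgm u) = u by rewrite sgmKf.
have E22m : sg2 (sg2 (sgm u)) = sgm u by rewrite sg2Kf.
have Em2m : sgm (sg2 (sgm u)) = sg2 u by rewrite -sgCf // sgmKf.
(* Relative norms of [u] to Q(i), Q(sqrt -2), Q(sqrt -m) and Q(sqrt -2m). *)
have [A1 A12] : u * sg2 u * (sgm u * sg2 (sgm u)) * (u * sg2 u * (sgm u * sg2 (sgm u)))^* = 1 /\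
    (u * sg2 u * (sgm u * sg2 (sgm u))) ^+ 12 = 1.
  apply: imag_unit_order; first by do !apply: unit_KfM.
    by left; rewrite !rmorphM /= E22 E22m; ring.
  by left; rewrite !rmorphM /= Em2 Emm Em2m; ring.
have [B1 B12] : u * (sg2 u)^* * (sgm u * (sg2 (sgm u))^*) * (u * (sg2 u)^* * (sgm u * (sg2 (sgm u))^*))^* = 1 /\
    (u * (sg2 u)^* * (sgm u * (sg2 (sgm u))^*)) ^+ 12 = 1.
  apply: imag_unit_order; first by do !apply: unit_KfM.
    by right; rewrite !rmorphM /= !sg2_conj // !conjCK E22 E22m; ring.
  by left; rewrite !rmorphM /= !sgm_conj // Em2 Emm Em2m; ring.
have [C1 C12] : u * sg2 u * ((sgm u)^* * (sg2 (sgm u))^*) * (u * sg2 u * ((sgm u)^* * (sg2 (sgm u))^*))^* = 1 /\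
    (u * sg2 u * ((sgm u)^* * (sg2 (sgm u))^*)) ^+ 12 = 1.
  apply: imag_unit_order; first by do !apply: unit_KfM.
    by left; rewrite !rmorphM /= !sg2_conj // E22 E22m; ring.
  by right; rewrite !rmorphM /= !sgm_conj // !conjCK Em2 Emm Em2m; ring.
have [D1 D12] : u * (sg2 u)^* * ((sgm u)^* * sg2 (sgm u)) * (u * (sg2 u)^* * ((sgm u)^* * sg2 (sgm u)))^* = 1 /\
    (u * (sg2 u)^* * ((sgm u)^* * sg2 (sgm u))) ^+ 12 = 1.
  apply: imag_unit_order; first by do !apply: unit_KfM.
    by right; rewrite !rmorphM /= !sg2_conj // !conjCK E22 E22m; ring.
  by right; rewrite !rmorphM /= !sgm_conj // !conjCK Em2 Emm Em2m; ring.
set A := _ * (sgm u * sg2 (sgm u)) in A1 A12; set B := _ * (sgm u * _) in B1 B12.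
set C := _ * (_ * _^*) in C1 C12; set D := _ * (_ * _) in D1 D12.
have Z1 : (A * B * C * D) * (A * B * C * D)^* = 1.
  have Mc (a b c d : algC) : (a * b * c * d) * (a * b * c * d)^* =
      (a * a^*) * (b * b^*) * (c * c^*) * (d * d^*) by rewrite !rmorphM /=; ring.
  by rewrite Mc A1 B1 C1 D1 !mulr1.
have Z12 : (A * B * C * D) ^+ 12 = 1.
  have MX (a b c d : algC) : (a * b * c * d) ^+ 12 = a ^+ 12 * b ^+ 12 * c ^+ 12 * d ^+ 12.
    by rewrite !exprMn.
  by rewrite MX A12 B12 C12 D12 !mulr1.
pose P := (sg2 u * (sg2 u)^* * (sgm u * (sgm u)^*) * (sg2 (sgm u) * (sg2 (sgm u))^*)) ^+ 2.
have DZ : A * B * C * D = u ^+ 4 * P by rewrite /A /B /C /D /P; ring.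
have Pc : P^* = P by rewrite /P rmorphXn !rmorphM /= !conjCK; ring.
have u0 := unit_of_neq0 Uu; have uc0 := unit_of_neq0 Uc.
have P0 : P != 0 by rewrite expf_neq0 // !mulf_neq0 ?fmorph_eq0.
have <- : (A * B * C * D) ^+ 12 = (u / u^*) ^+ 24.
  have E : (u / u^*) ^+ 4 = (A * B * C * D) ^+ 2.
    have Z0 : A * B * C * D != 0 by rewrite DZ mulf_neq0 // expf_neq0.
    have Zc : (A * B * C * D)^* = (A * B * C * D)^-1 by apply: (mulfI Z0); rewrite Z1 mulfV.
    transitivity (A * B * C * D / (A * B * C * D)^*); last by rewrite Zc invrK.
    have M2 (a b : algC) : (a * b)^* = a^* * b^* by rewrite rmorphM.
    rewrite DZ M2 Pc [(u ^+ 4)^*]rmorphXn /=.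
    by field; rewrite P0 uc0.
  by rewrite (exprM _ 4 6) E -exprM.
exact: Z12.
Qed.

(** The primitive 8th root of unity [exp(i pi / 4)]. *)
Definition z8 : algC := (1 + ii) / r.

Lemma Kf_z8 : Kf z8.
Proof.
apply/Kf_def; exists r^-1, r^-1; do ![split; first exact/KpV/Kp_2].
by rewrite /z8; ring.
Qed.

Lemma z8_sqr : z8 ^+ 2 = ii.
Proof.
have i2 := ii_sqr; have r0 : r != 0 by apply: rt_neq0.
rewrite expr_div_n (rt_sqr_nat 2) sqrrD expr1n i2 mul1r addrAC subrr add0r.
by rewrite -mulr_natr mulfK // pnatr_eq0.
Qed.

Lemma z8_conj : z8 * z8^* = 1.
Proof.
have i2 := ii_sqr; have r0 : r != 0 by apply: rt_neq0.
rewrite /z8 rmorphM fmorphV rmorphD rmorph1 /= conj_ii conj_rt mulf_div -expr2 (rt_sqr_nat 2).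
by have -> : (1 + ii) * (1 - ii) = 2 by [ring: i2]; rewrite mulfV ?pnatr_eq0.
Qed.

Lemma sg2_z8 : sg2 z8 = - z8.
Proof. by rewrite /z8 rmorphM fmorphV rmorphD rmorph1 /= sg2_i sg2_2 invrN mulrN. Qed.

(* Otherwise [g = f sg2(f)] satisfies [g = io conj(g)] with [io = i] or [- i], so that
   [h = g / (1 + io)] is real, lies in Q(sqrt m), and [g conj(g) = 2 h^2]. *)
Lemma xi_not_primitive f : unit_of Kf f -> (f / f^*) ^+ 4 = -1 -> False.
Proof.
move=> Uf; set xi := f / f^* => xi4; have Kff := proj1 Uf; have f0 := unit_of_neq0 Uf.
have fc0 := unit_of_neq0 (unit_conj Uf).
have xi0 : xi != 0 by rewrite mulf_neq0 ?invr_eq0.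
have [xi2 nxi] : (xi ^+ 2) ^+ 2 = -1 /\ sg2 xi = - xi.
  split; first by rewrite -exprM.
  (* So [xi] is [z8] or [i z8] up to sign, and [sg2] negates each of these. *)
  have : xi ^+ 4 == z8 ^+ 4 by rewrite xi4 (exprM _ 2 2) z8_sqr ii_sqr.
  rewrite !(exprM _ 2 2) eqf_sqr => /orP[].
    by rewrite eqf_sqr => /orP[]/eqP->; rewrite ?rmorphN /= sg2_z8.
  have -> : - z8 ^+ 2 = (ii * z8) ^+ 2 by rewrite (exprMn 2 ii z8) ii_sqr mulN1r.
  by rewrite eqf_sqr => /orP[]/eqP->; rewrite ?rmorphN rmorphM /= sg2_z8 sg2_i ?mulrN.
pose g := f * sg2 f; pose io := - xi ^+ 2.
have io2 : io ^+ 2 = -1 by rewrite sqrrN.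
have n2i : sg2 io = io by rewrite rmorphN rmorphXn /= nxi sqrrN.
have xi_c : xi^* = xi^-1 by rewrite /xi rmorphM fmorphV /= conjCK invf_div.
have io0 : io != 0 by rewrite oppr_eq0 expf_neq0.
have io_c : io^* = - io.
  rewrite rmorphN rmorphXn /= xi_c opprK exprVn; apply: (mulfI (expf_neq0 2 xi0)).
  by rewrite mulrN mulfV ?expf_neq0 // -expr2 xi2.
have Ug : unit_of Kf g by apply/unit_KfM/unit_Kf_sg2.
have Kg := proj1 Ug; have g_c : g = io * g^*.
  have -> : g^* = f^* * sg2 f^* by rewrite rmorphM /= sg2_conj.
  have -> : io = xi * sg2 xi by rewrite nxi mulrN -expr2.
  rewrite /xi rmorphM fmorphV /= sg2_conj // /g; field.
  by rewrite !fmorph_eq0 f0.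
have n2g : sg2 g = g by rewrite rmorphM sg2Kf // mulrC.
have oi : (1 + io) * (1 - io) = 2 by ring: io2.
have oi0 : 1 + io != 0.
  by apply/eqP => E; move/eqP: oi; rewrite E mul0r eq_sym pnatr_eq0.
have oi0' : 1 - io != 0.
  by apply/eqP => E; move/eqP: oi; rewrite E mulr0 eq_sym pnatr_eq0.
have Kxi : Kf xi by apply/KfM/KfV/Kf_conj.
have Kio : Kf (1 + io).
  have [u [v [Ku [Kv Dx]]]] : Kf (- xi ^+ 2).
    by rewrite -mulN1r; apply: KfM; [exact/Kp_Kf/KpN/Kp1 | exact: KfM].
  by exists (1 + u), v; split; [apply: KpD => //; exact: Kp1 | split=> //; rewrite /io Dx addrA].
pose h := g / (1 + io).
have Kh : Kp h.
  apply: Kf_fix_conj; first by apply/KfM/KfV.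
  rewrite rmorphM fmorphV rmorphD rmorph1 /= io_c /h [in RHS]g_c.
  rewrite (_ : 1 + io = io * (1 - io)); last by ring: io2.
  by field; rewrite io0 oi0'.
have Qh : Qsqrt m h.
  by apply: fix_sg2 => //; rewrite rmorphM fmorphV rmorphD rmorph1 /= n2g n2i.
have Ugg : unit_of Kp (g * g^*).
  by apply: unit_Kf_fix; [apply/unit_KfM/unit_conj | rewrite rmorphM /= conjCK mulrC].
apply: (@unit_not_twice_sqr (g * g^*) h) => //.
  split; last by case: Ugg.
  by apply: fix_sg2; [case: Ugg | rewrite rmorphM /= sg2_conj // n2g].
have Dg : g = (1 + io) * h by rewrite mulrC divfK.
by rewrite Dg rmorphM rmorphD rmorph1 /= io_c (Kp_conj Kh) -oi; ring.
Qed.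

(** Since [(f / conj f)^4] is not -1, it is 1, and [f / conj f] is a power of [i], the square of [w]
    among 1, [i], [z8], [i z8]. From [f = w^2 conj(f)] and [conj(w) = w^-1] it follows that [f / w]
    is real. *)
Lemma unit_over_conj_sqrt f : unit_of Kf f -> (f / f^*) ^+ 8 = 1 ->
  exists w, [/\ Kf w, w ^+ 16 = 1 & Kp (f / w)].
Proof.
move=> Uf xi8; have f0 := unit_of_neq0 Uf; have fc0 := unit_of_neq0 (unit_conj Uf).
suffices [w [Kw w16 w1 Dw]] : exists w, [/\ Kf w, w ^+ 16 = 1, w * w^* = 1 & w ^+ 2 = f / f^*].
  exists w; split=> //; apply: Kf_fix_conj; first by apply/KfM/KfV => //; case: Uf.
  have w0 : w != 0 by apply/eqP => w0; move/eqP: w1; rewrite w0 mul0r eq_sym oner_eq0.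
  rewrite rmorphM fmorphV /=; have -> : f = w ^+ 2 * f^* by rewrite Dw divfK.
  have -> : w^* = w^-1 by rewrite -[RHS]mulr1 -w1 mulKf.
  rewrite invrK rmorphM rmorphXn /= conjCK; have -> : w^* = w^-1 by rewrite -[RHS]mulr1 -w1 mulKf.
  by rewrite Dw; field; rewrite w0 fmorph_eq0 f0.
move: xi8; set xi := f / f^* => xi8.
have: (xi ^+ 4) ^+ 2 == 1 by rewrite -exprM xi8.
rewrite sqrf_eq1 => /orP[/eqP xi4|/eqP/(xi_not_primitive Uf) //].
have i4 : ii ^+ 4 = 1 by rewrite (exprM _ 2 2) ii_sqr sqrrN expr1n.
have i1 : ii * ii^* = 1 by rewrite conj_ii mulrN -expr2 ii_sqr opprK.
have z16 : z8 ^+ 16 = 1 by rewrite (exprM _ 2 8) z8_sqr (exprM _ 4 2) i4 expr1n.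
have : (xi ^+ 2) ^+ 2 == 1 by rewrite -exprM xi4.
rewrite sqrf_eq1 => /orP[].
  rewrite sqrf_eq1 => /orP[]/eqP->.
    by exists 1; rewrite !expr1n rmorph1 mulr1; split=> //; exact/Kp_Kf/Kp1.
  exists ii; rewrite ii_sqr i1 (exprM _ 4 4) i4 expr1n; split=> //; exact: Kf_i.
rewrite -ii_sqr eqf_sqr => /orP[]/eqP->.
  by exists z8; split; rewrite ?z8_sqr ?z8_conj //; exact: Kf_z8.
exists (ii * z8); split; first by apply: KfM; [exact: Kf_i | exact: Kf_z8].
- by rewrite (exprMn 16 ii z8) z16 (exprM _ 4 4) i4 expr1n mulr1.
- by rewrite rmorphM /= mulrACA i1 z8_conj mulr1.
by rewrite (exprMn 2 ii z8) z8_sqr ii_sqr mulN1r.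
Qed.

Lemma hasse : hasse_index_one Kf Kp.
Proof.
move=> e Ue; have Uc := unit_conj Ue; have [e0 c0] := (unit_of_neq0 Ue, unit_of_neq0 Uc).
have z24 := unit_over_conj_order Ue.
(* Cubing [e] removes the 3-part of the order of [e / conj e]. *)
have Ue3' : unit_of Kf (e ^+ 3) by rewrite !exprS expr0 mulr1; do !apply: unit_KfM.
have [|w [Kw w16 Kew]] := unit_over_conj_sqrt Ue3'.
  by rewrite rmorphXn /= -expr_div_n -exprM.
have w0 : w != 0 by apply/eqP => w0; move/eqP: w16; rewrite w0 expr0n eq_sym oner_eq0.
(* Dividing [e^3 = w (e^3 / w)] by [e^2 = (e / conj e) (e conj e)] splits [e] into the root of unity
   [w'] and a real factor; 48 is the least common multiple of 16 and 24. *)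
pose w' := w * (e / e^*)^-1.
have w'r : w' ^+ 48 = 1.
  by rewrite exprMn (exprM _ 16 3) w16 exprVn (exprM _ 24 2) z24 !expr1n invr1 mulr1.
have Kw' : Kf w' by apply/KfM/KfV/KfM/KfV/Kf_conj; case: Ue.
have Dec : e = w' * (e ^+ 3 / w * (e * e^*)^-1).
  by rewrite /w'; field; rewrite w0 e0 c0.
have w'0 : w' != 0 by rewrite !mulf_neq0 ?invr_eq0 ?mulf_neq0 ?invr_eq0.
have Aw' : w' \in Aint by apply: (@Aint_unity_root 48) => //; apply/unity_rootP.
have Aw'V : w'^-1 \in Aint.
  by apply: (@Aint_unity_root 48) => //; apply/unity_rootP; rewrite exprVn w'r invr1.
exists w', (e ^+ 3 / w * (e * e^*)^-1); split=> //; split; first by exists 48.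
split=> //; set u := _ * _^-1 in Dec *.
have Du : u = e * w'^-1 by rewrite Dec mulrAC mulfV ?mul1r.
split.
  apply: KpM => //; apply/KpV/Kf_fix_conj; last by rewrite rmorphM /= conjCK mulrC.
  by apply/KfM/Kf_conj; case: Ue.
case: Ue => _ [Ae [_ AeV]].
clearbody w'; rewrite Du invf_div; split; first by rewrite rpredM.
by split; [rewrite mulf_neq0 ?invr_eq0 | rewrite rpredM].
Qed.

(** * The four cases *)

Lemma pos_pm1 (A B n : algC) : 0 < A -> 0 < B -> A = B * n -> n = 1 \/ n = -1 -> n = 1.
Proof.
move=> A0 B0 E [] // Dn; move: A0; rewrite E Dn mulrN1 oppr_gt0 => /lt_trans/(_ B0).
by rewrite ltxx.
Qed.

Lemma pm1M (n n' : algC) : n = 1 \/ n = -1 -> n' = 1 \/ n' = -1 -> n * n' = 1 \/ n * n' = -1.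
Proof. by case=> -> []->; rewrite ?mulrNN ?mul1r ?mulr1 ?mulN1r; [left|right|right|left]. Qed.

Lemma pm1X (n : algC) (b : bool) : n = 1 \/ n = -1 -> n ^+ b = 1 \/ n ^+ b = -1.
Proof. by case: b; [rewrite expr1 | left; rewrite expr0]. Qed.

Lemma Kp_sqr_gt0 t : Kp t -> t != 0 -> 0 < t ^+ 2.
Proof. by move=> Kt t0; rewrite real_exprn_even_gt0 ?Kp_real. Qed.

(** The norm of [t^2] to a quadratic subfield is the square of a nonzero real number, hence
    positive. It is also a square of a power of one fundamental unit times the norms of the other
    two, so those signs multiply to 1. *)
Lemma sqr_norms (i j k : bool) t : Kp t -> t ^+ 2 = e1 ^+ i * e2 ^+ j * e3 ^+ k ->
  [/\ (e2 * sgm e2) ^+ j * (e3 * sgm e3) ^+ k = 1,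
      (-1) ^+ i * (e3 * sgm e3) ^+ k = 1 :> algC & (-1) ^+ i * (e2 * sgm e2) ^+ j = 1 :> algC].
Proof.
move=> Kt Dt; have [U1 g1 _] := fe1; have [U2 g2 _] := fe2; have [U3 g3 _] := fe3.
have t0 : t != 0.
  have := unit_monom i j k Ue1 Ue2 Ue3; rewrite -!exprnP -Dt => /unit_of_neq0.
  by rewrite expf_eq0.
have [N1 N2 N3] := And3 (norm_Q2 U1) (norm_Qm U2) (norm_Q2m U3).
have [Km K2] := (Kp_sgm Kt, Kp_sg2 Kt); have K2m := Kp_sg2 Km.
have sqr_pos nu' : Kp (nu' t) -> nu' t != 0 -> 0 < (t * nu' t : algC) ^+ 2.
  by move=> K' n0; apply: Kp_sqr_gt0; [exact: KpM | rewrite mulf_neq0].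
have Q1 := sgm_Qsqrt2 (proj1 U1); have Q2 := sg2_Qsqrtm (proj1 U2).
have Q3 := sg2_Qsqrt2m (proj1 U3).
have Ke2 : Kp e2 by case: Ue2.
have Ke3 : Kp e3 by case: Ue3.
have ee (e : algC) (b : bool) : 0 < e -> 0 < e ^+ b * e ^+ b by move=> h; rewrite mulr_gt0 ?exprn_gt0.
split.
- apply: (pos_pm1 (sqr_pos sgm _ _) (ee _ i e1_gt0)); rewrite ?fmorph_eq0 //.
    by rewrite exprMn -rmorphXn /= Dt !rmorphM !rmorphXn /= Q1 !exprMn; ring.
  by apply: pm1M; exact: pm1X.
- apply: (pos_pm1 (sqr_pos sg2 _ _) (ee _ j e2_gt0)); rewrite ?fmorph_eq0 //.
    by rewrite exprMn -rmorphXn /= Dt !rmorphM !rmorphXn /= Q2 Q3 -norm_e1 !exprMn; ring.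
  by apply: pm1M; apply: pm1X => //; right.
- apply: (pos_pm1 (sqr_pos (sg2 \o sgm) _ _) (ee _ k e3_gt0)); rewrite /= ?fmorph_eq0 //.
    rewrite exprMn -!rmorphXn /= Dt !rmorphM !rmorphXn /= Q1 (sgC Ke2) Q2 -Q3 sg2K // -norm_e1 !exprMn.
    by ring.
  by apply: pm1M; apply: pm1X => //; right.
Qed.

(** * Square classes of [e3] and of units of norm 1 *)

Variables (x y : int).
Hypothesis De3 : e3 = x%:~R + y%:~R * rt (2 * m).

Lemma sgm_rt2m : sgm (rt (2 * m)) = - rt (2 * m).
Proof. by rewrite rtM rmorphM sgm_2 sgm_m mulrN. Qed.

Lemma sgm_e3 : sgm e3 = x%:~R - y%:~R * rt (2 * m).
Proof. by rewrite De3 rmorphD rmorphM !rmorph_int sgm_rt2m mulrN. Qed.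

Lemma int_sqr_nat (z : int) : exists k : nat, z ^+ 2 = (k ^ 2)%N%:Z.
Proof. by exists `|z|%N; rewrite -abszX abszE ger0_norm ?sqr_ge0. Qed.

(** A root fixed by [sg2 sgm] would lie in Q(sqrt(2m)), so [t = sqrt 2 (a + b sqrt(2m))]. Then
    [x = 2 a^2 + 4 m b^2], and [d = 2 a^2 - 4 m b^2] is 1 or -1 by the norm of [e3], so
    [x + d = (2 a)^2]. *)
Lemma e3_sqr_succ_or_pred t : Kp t -> t ^+ 2 = e3 ->
  exists k : nat, x + 1 = (k ^ 2)%N%:Z \/ x - 1 = (k ^ 2)%N%:Z.
Proof.
move=> Kt Dt; have Ut := unit_Kp_sqrt Ue3 Kt Dt.
have Q3 : Qsqrt (2 * m) e3 by case: fe3 => [[]].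
have : sg2 (sgm t) ^+ 2 == t ^+ 2.
  rewrite -!rmorphXn /= Dt -(sg2_Qsqrt2m Q3) sg2K //; exact: Qsqrt2m_Kp.
rewrite eqf_sqr => /orP[]/eqP E.
  have [] := fund_unit_not_sqr fe3 _ Dt; split; first exact: fix_sg2m.
  by case: Ut.
have [t' /Qsqrt_def[a [b Dt']] Dtt'] := neg_sg2m Kt E.
have s2 := rt_sqr_nat (2 * m).
have De : e3 = 2 * t' ^+ 2 by rewrite -Dt Dtt' exprMn rt_sqr_nat.
have Dnt : sgm t' = ratr a - ratr b * rt (2 * m).
  by rewrite Dt' !(fmorph_rat, rmorphD, rmorphM) /= sgm_rt2m; ring.
have Dne : sgm e3 = 2 * sgm t' ^+ 2 by rewrite De rmorphM rmorphXn rmorph_nat.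
have [q2 Dq2 Rq2] : exists2 q : rat, q = 2 & ratr q = 2 :> algC by exists 2; rewrite ?ratr_nat.
have [w Rw] : exists w : rat, ratr w = (2 * m)%:R :> algC by exists (2 * m)%:R; rewrite ratr_nat.
have Ex : q2 * a ^+ 2 + q2 * w * b ^+ 2 = x%:~R.
  apply: ratr_inj; rewrite ratr_int.
  have -> : x%:~R = (e3 + sgm e3) / 2 by rewrite sgm_e3 De3; field.
  by rewrite Dne De Dnt Dt' !(rmorphD, rmorphM, rmorphXn) /= Rq2 Rw -s2; field.
have [d Dd Ed] : exists2 d : int, d = 1 \/ d = -1 & q2 * (a ^+ 2 - w * b ^+ 2) = d%:~R :> rat.
  have E4 : e3 * sgm e3 = ratr ((q2 * (a ^+ 2 - w * b ^+ 2)) ^+ 2).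
    by rewrite Dne De Dnt Dt' !(rmorphB, rmorphM, rmorphXn) /= Rq2 Rw -s2; ring.
  have E1 : (q2 * (a ^+ 2 - w * b ^+ 2)) ^+ 2 = 1.
    apply: ratr_inj; rewrite -E4 rmorph1.
    case: (@norm_Q2m e3) => //; first by case: fe3.
    move=> E'; have := sqr_ge0 (q2 * (a ^+ 2 - w * b ^+ 2)); rewrite -(ler0q algC) -E4 E'.
    by rewrite oppr_ge0 ler10.
  move/eqP: E1; rewrite sqrf_eq1 => /orP[]/eqP->; [exists 1 | exists (-1)] => //; last by right.
  by left.
have E2a : (2 * a) ^+ 2 = (x + d)%:~R by rewrite intrD -Ex -Ed Dq2; ring.
have [z Dz] := rat_sqr_int E2a; have [k Dk] := int_sqr_nat z; exists k; rewrite -Dk.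
have -> : z ^+ 2 = x + d by apply: (@intr_inj rat); rewrite rmorphXn /= -Dz.
by case: Dd => ->; [left | right].
Qed.

Lemma norm_e3_xy : e3 * sgm e3 = 1 -> x ^+ 2 - (2 * m)%N%:Z * y ^+ 2 = 1.
Proof.
move=> E; apply: (@intr_inj algC); rewrite -[RHS]E sgm_e3 De3 !expr2 intrB !intrM.
rewrite (_ : (2 * m)%N%:Z%:~R = rt (2 * m) ^+ 2); first by ring.
by rewrite rt_sqr_nat.
Qed.

Lemma Kp_rt2m : Kp (rt (2 * m)).
Proof. by rewrite rtM; apply: KpM; [exact: Kp_2 | exact: Kp_m]. Qed.

Lemma Kp_int (z : int) : Kp z%:~R.
Proof. by have := Kp_rat z%:~R; rewrite ratr_int. Qed.

(** With [x + d = k^2] and [d] equal to 1 or -1, norm 1 reads [(x + d)(x - d) = 2 m y^2], so [(k + y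
    sqrt(2m) / k)^2 = (x + d) + (x - d) + 2 y sqrt(2m) = 2 e3]. *)
Lemma e3_sqrt (k : nat) : e3 * sgm e3 = 1 ->
  x + 1 = (k ^ 2)%N%:Z \/ x - 1 = (k ^ 2)%N%:Z -> exists2 t, Kp t & t ^+ 2 = e3.
Proof.
move=> /norm_e3_xy Exy Dk.
have [d d2 {}Dk] : exists2 d : int, d ^+ 2 = 1 & x + d = k%:Z ^+ 2.
  by case: Dk => Dk; [exists 1 | exists (-1)]; rewrite // Dk -PoszX.
(* Otherwise [x = - d], norm 1 forces [y = 0], and [e3^2 = 1] contradicts [e3 > 1]. *)
have k0 : k != 0%N.
  apply/eqP => k0; rewrite k0 in Dk.
  have Dx : x = - d by apply/eqP; rewrite -addr_eq0 Dk.
  have y0 : y = 0 by move: Exy; rewrite Dx sqrrN d2; nia.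
  have : e3 ^+ 2 = 1 by rewrite De3 y0 mul0r addr0 -rmorphXn /= Dx sqrrN d2.
  have [_ g3 _] := fe3; move/eqP; rewrite pexpr_eq1 ?gt_eqF //.
  exact/ltW/e3_gt0.
have Kk : Kp k%:R by exact: (Kp_int k).
(* The square root of [e3] is [sqrt ((x + 1) / 2) + sqrt ((x - 1) / 2)]. *)
exists ((k%:R + y%:~R * rt (2 * m) / k%:R) / r).
  apply/KpM/KpV/Kp_2/KpD/KpM/KpV => //; apply: KpM; [exact: Kp_int | exact: Kp_rt2m].
have kC : k%:R != 0 :> algC by rewrite pnatr_eq0.
have k2 : k%:R ^+ 2 = x%:~R + d%:~R :> algC.
  by rewrite -intrD Dk rmorphXn.
have y2 : (2 * m)%:R * y%:~R ^+ 2 = x%:~R ^+ 2 - d%:~R ^+ 2 :> algC.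
  have -> : (2 * m)%:R = (2 * m)%N%:Z%:~R :> algC by [].
  by rewrite -!rmorphXn -rmorphM d2 -rmorphB /=; congr (_%:~R); lia.
rewrite expr_div_n rt_sqr_nat De3; apply: (mulIf (_ : 2 * k%:R ^+ 2 != 0)).
  by rewrite mulf_neq0 ?expf_neq0 ?pnatr_eq0.
have -> : (k%:R + y%:~R * rt (2 * m) / k%:R) ^+ 2 / 2 * (2 * k%:R ^+ 2) =
  k%:R ^+ 2 * k%:R ^+ 2 + 2 * k%:R ^+ 2 * (y%:~R * rt (2 * m)) + (rt (2 * m)) ^+ 2 * y%:~R ^+ 2.
  by field.
by rewrite rt_sqr_nat y2 k2; ring.
Qed.

(* [P] and [M] are [Tr u + 2] and [Tr u - 2]. *)
Lemma trace_square_class (l : nat) u : unit_of Kp u -> Qsqrt l u -> sgm (rt l) = - rt l ->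
  1 < u -> u * sgm u = 1 -> exists P M c : nat,
  [/\ (u + 1) ^+ 2 = u * P%:R, P = (M + 4)%N, (0 < M)%N & (l * (P * M) = c ^ 2)%N].
Proof.
move=> Uu /Qsqrt_def[a [b Du]] sgm_l u1 Nu.
have u_gt0 : 0 < u by apply: lt_trans u1; exact: ltr01.
have Dn : sgm u = ratr a - ratr b * rt l.
  by rewrite Du !(fmorph_rat, rmorphD, rmorphM) /= sgm_l; ring.
have Dt : u + sgm u = ratr (a + a) by rewrite Dn Du rmorphD /=; ring.
have At : u + sgm u \in Aint.
  by case: Uu => _ [Au _]; rewrite rpredD ?Aint_aut.
have Qt : u + sgm u \in Crat by rewrite Dt Crat_rat.
have /intrP[k Dk] := Cint_rat_Aint Qt At.
(* By norm 1, [u (k - 2) = (u - 1)^2], which is positive. *)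
have k2 : 2 < k.
  suffices : 0 < u + sgm u - 2 by rewrite Dk subr_gt0 -(ltr_int algC).
  rewrite -(pmulr_rgt0 _ u_gt0).
  have -> : u * (u + sgm u - 2) = (u - 1) ^+ 2 by ring: Nu.
  by rewrite exprn_gt0 // subr_gt0.
have Dkq : a + a = k%:~R by apply: ratr_inj; rewrite -Dt Dk ratr_int.
have [w Rw Dw] : exists2 w : rat, ratr w = l%:R :> algC & w = l%:R by exists l%:R; rewrite ?ratr_nat.
have Nab : a ^+ 2 - w * b ^+ 2 = 1.
  apply: ratr_inj; rewrite rmorph1 -Nu Dn Du !(rmorphB, rmorphM, rmorphXn) /= Rw -rt_sqr_nat.
  by ring.
(* From [k = 2 a] and [a^2 - l b^2 = 1] one gets [(2 b l)^2 = l (k + 2)(k - 2)], so [2 b l] is an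
   integer and gives [c]. *)
have [z Dz] : exists z : int, 2 * b * w = z%:~R.
  apply: (@rat_sqr_int _ (l%:Z * (k ^+ 2 - 4))).
  rewrite intrM intrB -[(k ^+ 2)%:~R]/((k * k)%:~R) intrM -Dkq -[l%:Z%:~R]Dw.
  have -> : 4%:~R = 4 * (a ^+ 2 - w * b ^+ 2) by rewrite Nab mulr1.
  by ring.
exists (absz (k + 2)%R), (absz (k - 2)%R), (absz z); split; [|lia|lia|].
  have -> : (absz (k + 2))%:R = (k + 2)%:~R :> algC.
    by rewrite -[in RHS](@gez0_abs (k + 2)) //; lia.
  by rewrite intrD -Dk; ring: Nu.
have : l%:Z * ((k + 2) * (k - 2)) = z ^+ 2; last by nia.
apply: (@intr_inj rat); rewrite [RHS]rmorphXn /= -Dz !intrM intrD intrB -Dkq -[l%:Z%:~R]Dw.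
have E4 : 4 = 4 * (a ^+ 2 - w * b ^+ 2) by rewrite Nab mulr1.
have -> : (a + a + 2) * (a + a - 2) = 4 * a ^+ 2 - 4 by ring.
by rewrite {2}E4; ring.
Qed.

Variables (p1 p2 : nat).
Hypotheses (p1_pr : prime p1) (p2_pr : prime p2) (p12 : p1 != p2).
Hypotheses (p1_2 : p1 != 2%N) (p2_2 : p2 != 2%N) (Dm : m = (p1 * p2)%N).

(** If [P d = r'^2], then [(u + 1)^2 = u P] makes [u] the square of [(u + 1) sqrt d / r'], and
    [sqrt d] lies in K+ for each of the four possible [d]. The other case carries a factor [p1]. *)
Lemma unit_sqrt_class l u : l = m \/ l = (2 * m)%N -> unit_of Kp u -> Qsqrt l u ->
  1 < u -> u * sgm u = 1 ->
  (exists2 t, Kp t & t ^+ 2 = u) \/ (exists2 t, Kp t & t ^+ 2 = p1%:R * u).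
Proof.
move=> Dl Uu Qu u1 Nu.
have sgm_l : sgm (rt l) = - rt l by case: Dl => -> //; exact: sgm_rt2m.
have [P [M [c [Eu DP M_gt0 Ec]]]] := trace_square_class Uu Qu sgm_l u1 Nu.
rewrite Dm in Dl; have [d [r' [Sd Dr]]] := square_class p1_pr p2_pr p12 p1_2 p2_2 Dl M_gt0 DP Ec.
have d_gt0 : (0 < d)%N.
  by move: Sd; rewrite !inE => /or4P[]/eqP-> //; rewrite ?muln_gt0 ?prime_gt0.
have Kd : Kp (rt d).
  move: Sd; rewrite -Dm !inE => /or4P[]/eqP->; [|exact: Kp_2 | exact: Kp_m | exact: Kp_rt2m].
  by rewrite /rt sqrtC1; exact: Kp1.
have Kn (n : nat) : Kp n%:R by exact: (Kp_int n).
have P0 : P%:R != 0 :> algC by rewrite pnatr_eq0 DP addn4.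
have p0 : p1%:R != 0 :> algC by rewrite pnatr_eq0 -lt0n prime_gt0.
have d0 : rt d != 0 by apply: rt_neq0.
have D0 : d%:R != 0 :> algC by rewrite pnatr_eq0 -lt0n.
have Kt n : Kp ((u + 1) * (n%:R * rt d / r'%:R)).
  apply: KpM; first by apply: KpD; [case: Uu | exact: Kp1].
  by apply: KpM; [exact: KpM | exact: KpV].
case: Dr => Dr; [left | right].
  have EC : P%:R * d%:R = r'%:R ^+ 2 :> algC by rewrite -natrM Dr natrX.
  exists ((u + 1) * (1%:R * rt d / r'%:R)) => //.
  rewrite mul1r exprMn expr_div_n Eu rt_sqr_nat -EC; field.
  by rewrite P0 D0.
have EC : p1%:R * P%:R * d%:R = r'%:R ^+ 2 :> algC by rewrite -!natrM Dr natrX.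
exists ((u + 1) * (p1%:R * rt d / r'%:R)) => //.
rewrite exprMn expr_div_n exprMn Eu rt_sqr_nat -EC; field.
by rewrite P0 D0 p0.
Qed.

(** Neither unit being a square, [p1 e2] and [p1 e3] both are, and their product is [p1^2 e2 e3]. *)
Lemma e2e3_sqrt : e2 * sgm e2 = 1 -> e3 * sgm e3 = 1 ->
  ~ (exists2 t, Kp t & t ^+ 2 = e3) -> exists2 t, Kp t & t ^+ 2 = e2 * e3.
Proof.
move=> N2 N3 ns3; have [[Q2 _] g2 _] := fe2; have [[Q3 _] g3 _] := fe3.
have [[t Kt Dt]|[t Kt Dt]] := unit_sqrt_class (or_introl erefl) Ue2 Q2 g2 N2.
  by case: (e2_not_sqr Kt Dt).
have [//|[t' Kt' Dt']] := unit_sqrt_class (or_intror erefl) Ue3 Q3 g3 N3.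
have p0 : p1%:R != 0 :> algC by rewrite pnatr_eq0 -lt0n prime_gt0.
exists (t * t' / p1%:R); first by apply/KpM/KpV/(Kp_int p1)/KpM.
by rewrite expr_div_n exprMn Dt Dt'; field.
Qed.

Lemma fsu_cases :
  hasse_index_one Kf Kp /\
  (normQ m e2 (-1) -> normQ (2 * m) e3 (-1) ->
     ((exists s, Kp s /\ s ^+ 2 = e1 * e2 * e3) ->
        FSU Kp e1 e2 (sqrtC (e1 * e2 * e3)) /\ FSU Kf e1 e2 (sqrtC (e1 * e2 * e3))) /\
     (~ (exists s, Kp s /\ s ^+ 2 = e1 * e2 * e3) -> FSU Kp e1 e2 e3 /\ FSU Kf e1 e2 e3)) /\
  (normQ m e2 1 -> normQ (2 * m) e3 (-1) -> FSU Kp e1 e2 e3 /\ FSU Kf e1 e2 e3) /\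
  (normQ (2 * m) e3 1 -> normQ m e2 (-1) ->
     ((exists k : nat, x + 1 = (k ^ 2)%:Z \/ x - 1 = (k ^ 2)%:Z) ->
        FSU Kp e1 e2 (sqrtC e3) /\ FSU Kf e1 e2 (sqrtC e3)) /\
     (~ (exists k : nat, x + 1 = (k ^ 2)%:Z \/ x - 1 = (k ^ 2)%:Z) ->
        FSU Kp e1 e2 e3 /\ FSU Kf e1 e2 e3)) /\
  (normQ m e2 1 -> normQ (2 * m) e3 1 ->
     ((exists k : nat, x + 1 = (k ^ 2)%:Z \/ x - 1 = (k ^ 2)%:Z) ->
        FSU Kp e1 e2 (sqrtC e3) /\ FSU Kf e1 e2 (sqrtC e3)) /\
     (~ (exists k : nat, x + 1 = (k ^ 2)%:Z \/ x - 1 = (k ^ 2)%:Z) ->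
        FSU Kp e1 e2 (sqrtC (e2 * e3)) /\ FSU Kf e1 e2 (sqrtC (e2 * e3)))).
Proof.
have FSU_both f1 f2 f3 : FSU Kp f1 f2 f3 -> FSU Kp f1 f2 f3 /\ FSU Kf f1 f2 f3.
  by move=> H; split=> //; exact: FSU_Kf hasse H.
have N1m : (-1 : algC) <> 1 by move/eqP; rewrite eq_sym -addr_eq0 -mulr2n pnatr_eq0.
have sqr3 : (exists2 t, Kp t & t ^+ 2 = e3) ->
    (forall (i j k : bool) t, Kp t -> t ^+ 2 = e1 ^+ i * e2 ^+ j * e3 ^+ k -> ~~ i /\ (~~ k -> ~~ j) /\ (k -> ~~ j)) ->
    FSU Kp e1 e2 (sqrtC e3).
  move=> [t Kt Dt] H; have := @FSU_Kp_sqrt false false t Kt; rewrite !expr0 !mul1r; apply=> //.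
  move=> i j k t' Kt' Dt'; have [i0 [j0 j1]] := H _ _ _ _ Kt' Dt'.
  by case: k j0 j1 {Dt'} => [_ /(_ isT) j0|/(_ isT) j0 _]; [right; split=> //; exact: negbTE | left].
split; first exact: hasse.
split=> [/normQ_m N2 /normQ_2m N3|].
  (* Both norms being -1, the sign conditions leave only equal exponents. *)
  have alleq (i j k : bool) t : Kp t -> t ^+ 2 = e1 ^+ i * e2 ^+ j * e3 ^+ k -> i = k /\ j = k.
    move=> Kt Dt; have [] := sqr_norms Kt Dt; rewrite N2 N3.
    by case: i j k {Dt} => [] [] []; rewrite ?(expr0, expr1, mul1r, mulr1, mulrNN) // => A B C; exfalso; auto.
  split=> [[t [Kt Dt]]|ns]; apply: FSU_both.
    have := @FSU_Kp_sqrt true true t Kt; rewrite !expr1; apply=> //.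
    move=> i j k t' Kt' Dt'; have [Di Dj] := alleq _ _ _ _ Kt' Dt'.
    by case: k i j Di Dj {Dt'} => [] i j -> ->; [right | left].
  apply: FSU_Kp_trivial => i j k t Kt Dt; have [Di Dj] := alleq _ _ _ _ Kt Dt.
  case: k i j Di Dj Dt => [] i j -> -> //; rewrite !expr1 => Dt.
  by case: ns; exists t.
split=> [/normQ_m N2 /normQ_2m N3|].
  (* The signs force [i = k = 0], and [e2] alone is not a square. *)
  apply: FSU_both; apply: FSU_Kp_trivial => i j k t Kt Dt.
  have [] := sqr_norms Kt Dt; rewrite N2 N3.
  case: i j k Dt => [] [] []; rewrite ?(expr0, expr1, mul1r, mulr1, mulrNN) // => Dt A B C; try by exfalso; auto.
  by case: (e2_not_sqr Kt Dt).
split=> [/normQ_2m N3 /normQ_m N2|/normQ_m N2 /normQ_2m N3].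
  have ij0 (i j k : bool) t : Kp t -> t ^+ 2 = e1 ^+ i * e2 ^+ j * e3 ^+ k -> ~~ i /\ ~~ j.
    move=> Kt Dt; have [] := sqr_norms Kt Dt; rewrite N2 N3.
    by case: i j k {Dt} => [] [] []; rewrite ?(expr0, expr1, mul1r, mulr1, mulrNN) ?expr1n // => A B C; exfalso; auto.
  split=> [[k Dk]|ns]; apply: FSU_both.
    apply: sqr3; first exact: e3_sqrt Dk.
    by move=> i j k' t Kt Dt; have [i0 j0] := ij0 _ _ _ _ Kt Dt.
  apply: FSU_Kp_trivial => i j k t Kt Dt; have [/negbTE i0 /negbTE j0] := ij0 _ _ _ _ Kt Dt.
  move: Dt; rewrite i0 j0 !expr0 !mul1r; case: k => // Dt.
  by case: ns; exact: e3_sqr_succ_or_pred Dt.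
have i0 (i j k : bool) t : Kp t -> t ^+ 2 = e1 ^+ i * e2 ^+ j * e3 ^+ k -> ~~ i.
  move=> Kt Dt; have [_ + _] := sqr_norms Kt Dt; rewrite N3 expr1n mulr1.
  by case: i {Dt} => //; rewrite expr1.
split=> [[k Dk]|ns]; apply: FSU_both.
  have [t0 Kt0 Dt0] := e3_sqrt N3 Dk.
  apply: sqr3; first by exists t0.
  move=> i j k' t Kt Dt; have /negbTE i1 := i0 _ _ _ _ Kt Dt.
  move: Dt; rewrite i1 expr0 mul1r; case: j => // Dt; exfalso.
  case: k' Dt => Dt; last by case: (@e2_not_sqr t) => //; rewrite Dt mulr1.
  (* Were [e2 e3] a square besides [e3], their quotient [e2] would be one. *)
  case: (@e2_not_sqr (t / t0)); first exact/KpM/KpV.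
  by rewrite expr_div_n Dt Dt0 mulfK // (unit_of_neq0 Ue3).
have ns3 : ~ exists2 t, Kp t & t ^+ 2 = e3.
  by move=> [t Kt /(e3_sqr_succ_or_pred Kt)].
have [t0 Kt0 Dt0] := e2e3_sqrt N2 N3 ns3.
have := @FSU_Kp_sqrt false true t0 Kt0; rewrite !expr0 !expr1 !mul1r; apply=> //.
move=> i j k t Kt Dt; have /negbTE i1 := i0 _ _ _ _ Kt Dt.
(* Neither [e2] nor [e3] is a square, which leaves the trivial product and [e2 e3]. *)
move: Dt; rewrite i1 expr0 mul1r; case: j k => [] [] Dt; [by right | | | by left].
  by case: (@e2_not_sqr t) => //; rewrite Dt mulr1.
by case: ns3; exists t => //; rewrite Dt mul1r.
Qed.

End Biquadratic.

Theorem theorem2 (p1 p2 : nat) (e1 e2 e3 : algC) (x y : int) :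
  prime p1 -> prime p2 -> p1 != p2 ->
  (p1 %% 4 = 1)%N -> (p2 %% 4 = 1)%N ->
  fund_unit 2 e1 -> fund_unit (p1 * p2) e2 -> fund_unit (2 * (p1 * p2)) e3 ->
  e3 = x%:~R + y%:~R * sqrtC (2 * (p1 * p2))%:R ->
  let m := (p1 * p2)%N in
  hasse_index_one (Kfull m) (Kplus m) /\
  (* (1) *)
  (normQ m e2 (-1) -> normQ (2 * m) e3 (-1) ->
     ((exists s, Kplus m s /\ s ^+ 2 = e1 * e2 * e3) ->
        FSU (Kplus m) e1 e2 (sqrtC (e1 * e2 * e3)) /\
        FSU (Kfull m) e1 e2 (sqrtC (e1 * e2 * e3))) /\
     (~ (exists s, Kplus m s /\ s ^+ 2 = e1 * e2 * e3) ->
        FSU (Kplus m) e1 e2 e3 /\ FSU (Kfull m) e1 e2 e3)) /\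
  (* (2) *)
  (normQ m e2 1 -> normQ (2 * m) e3 (-1) ->
     FSU (Kplus m) e1 e2 e3 /\ FSU (Kfull m) e1 e2 e3) /\
  (* (3) *)
  (normQ (2 * m) e3 1 -> normQ m e2 (-1) ->
     ((exists k : nat, x + 1 = (k ^ 2)%:Z \/ x - 1 = (k ^ 2)%:Z) ->
        FSU (Kplus m) e1 e2 (sqrtC e3) /\ FSU (Kfull m) e1 e2 (sqrtC e3)) /\
     (~ (exists k : nat, x + 1 = (k ^ 2)%:Z \/ x - 1 = (k ^ 2)%:Z) ->
        FSU (Kplus m) e1 e2 e3 /\ FSU (Kfull m) e1 e2 e3)) /\
  (* (4) *)
  (normQ m e2 1 -> normQ (2 * m) e3 1 ->
     ((exists k : nat, x + 1 = (k ^ 2)%:Z \/ x - 1 = (k ^ 2)%:Z) ->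
        FSU (Kplus m) e1 e2 (sqrtC e3) /\ FSU (Kfull m) e1 e2 (sqrtC e3)) /\
     (~ (exists k : nat, x + 1 = (k ^ 2)%:Z \/ x - 1 = (k ^ 2)%:Z) ->
        FSU (Kplus m) e1 e2 (sqrtC (e2 * e3)) /\
        FSU (Kfull m) e1 e2 (sqrtC (e2 * e3)))).
Proof.
move=> p1_pr p2_pr p12 p1_mod p2_mod f1 f2 f3 De3 m.
have [p1_gt0 p2_gt0] := (prime_gt0 p1_pr, prime_gt0 p2_pr).
have p1_2 : p1 != 2%N by apply: contra_eq_neq p1_mod => ->.
have p2_2 : p2 != 2%N by apply: contra_eq_neq p2_mod => ->.
have m_gt0 : (0 < m)%N by rewrite muln_gt0 p1_gt0 p2_gt0.
have m_mod : (m %% 4 = 1)%N by rewrite -modnMm p1_mod p2_mod.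
(* The odd valuation at [p1] shows that neither [m] nor [2 m] is a rational square. *)
have odd_m : logn p1 m = 1%N.
  by rewrite lognM // !logn_prime // eqxx (negbTE p12).
have ns2 (q : rat) : q ^+ 2 <> 2%:R by apply: (@odd_logn_not_square 2 2) => //; rewrite logn_prime.
have nsm (q : rat) : q ^+ 2 <> m%:R.
  by apply: (@odd_logn_not_square p1 m) => //; rewrite odd_m.
have ns2m (q : rat) : q ^+ 2 <> (2 * m)%:R.
  by apply: (@odd_logn_not_square p1 (2 * m)) => //; rewrite lognM // odd_m logn_prime // (negbTE p1_2).
have [sg2 [sg2_2 sg2_m sg2_i]] := aut_sqrt_nat ns2 nsm ns2m.
have nsm2 (q : rat) : q ^+ 2 <> (m * 2)%:R by rewrite mulnC; exact: ns2m.
have [sgm [sgm_m sgm_2 sgm_i]] := aut_sqrt_nat nsm ns2 nsm2.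
exact: (fsu_cases m_gt0 sg2_2 sg2_m sg2_i sgm_2 sgm_m sgm_i m_mod f1 f2 f3 De3 p1_pr p2_pr p12).
Qed.
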